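(* For every integer $k \geq 1$ and every integer $n \geq 2k$, the chromatic number of the graph $\mathrm{XG}(n,k)$ is $\chi(\mathrm{XG}(n,k)) = n-2k+2$. Moreover, $\mathrm{XG}(n,k)$ is edge-critical.
   Context: Notation: $[n]=\{1,\dots,n\}$, viewed as the vertex set of the $n$-cycle $C_n$ (edges between consecutive integers and between $n$ and $1$), with $1,\dots,n$ in clockwise order. For $a,b\in[n]$, the interval $[a,b]$ is the set $\{a,a+1,\dots,b\}$ of elements met when going clockwise from $a$ to $b$ (arithmetic cyclic, $n+1=1$); thus $[a,a]=\{a\}$ and $[b+1,b]=[n]$. For $X\subseteq[n]$, $[a,b]_X=[a,b]\cap X$. Schrijver graph: $\mathrm{SG}(n,k)$ has as vertices all $k$-element subsets of $[n]$ containing no two elements adjacent in $C_n$; two vertices are adjacent if and only if they are disjoint. Interlacing pair: disjoint sets $A,B\subseteq[n]$ form an interlacing pair if the elements of $A$ alternate with those of $B$ as one goes along $C_n$ from $1$ to $n$ (no two successive elements of $A\cup B$ belong to the same one of the sets $A,B$). Admissible interval: for disjoint $A,B\subseteq[n]$ and $c,d\in[n]$, the interval $[d,c]$ is weakly $AB$-admissible if $|[d,c]_A|=|[d,c]_B|=c$; it is $AB$-admissible if moreover $c,d\notin A\cup B$. Switching: switching a pair $AB$ of subsets of $[n]$ at $[d,c]$ produces the pair $A'B'$ with $A'=A\mathbin{\triangle}[d,c]_{A\cup B}$ and $B'=B\mathbin{\triangle}[d,c]_{A\cup B}$ ($\triangle$ is symmetric difference). Switching along a sequence of intervals means switching at each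 of them successively, in the given order (the empty sequence gives the identity). Almost-interlacing pair: a pair $AB$ of vertices of $\mathrm{SG}(n,k)$ with $A\cap B=\emptyset$ is almost-interlacing if there are an integer $m\ge 0$ and a set $C\cup D\subseteq[n]$, $C=\{c_1,\dots,c_m\}$, $D=\{d_1,\dots,d_m\}$, such that: (1) $1\le c_1<c_2<\dots<c_m\le k-1$; (2) $k+1\le d_m<d_{m-1}<\dots<d_1\le n$; (3) each interval $[d_i,c_i]$ is $AB$-admissible; (4) switching $AB$ along the sequence $[d_1,c_1],\dots,[d_m,c_m]$ yields an interlacing pair. $\mathrm{XG}(n,k)$ is the spanning subgraph of $\mathrm{SG}(n,k)$ whose edges are all almost-interlacing pairs. A graph is edge-critical if the removal of any edge decreases its chromatic number; in other words, if any proper subgraph (not necessarily induced) has smaller chromatic number than the graph itself. *)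

(* Defs.v *)
From mathcomp Require Import all_boot.

Set Implicit Arguments.
Unset Strict Implicit.
Unset Printing Implicit Defensive.

Section Graphs.

Variable T : finType.

Record graph := Graph {
  vertices : {set T};
  edges : {set {set T}};
  edgesP : forall e, e \in edges -> e \subset vertices /\ #|e| = 2
}.

Definition adjacent (G : graph) (x y : T) : bool := [set x; y] \in edges G.

Definition colorable (G : graph) (m : nat) : bool :=
  [exists f : {ffun {x : T | x \in vertices G} -> 'I_m},
    [forall x, forall y, adjacent G (val x) (val y) ==> (f x != f y)]].

Lemma colorable_ex (G : graph) : exists m, colorable G m.
Proof.
exists #|{: {x : T | x \in vertices G}}|; apply/existsP.
exists [ffun x => enum_rank x]; apply/forallP=> x; apply/forallP=> y.
apply/implyP=> /edgesP[_]; rewrite !ffunE (inj_eq enum_rank_inj).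
by apply: contra_eqN => /eqP->; rewrite cards2 eqxx.
Qed.

Definition chromatic_number (G : graph) : nat := ex_minn (colorable_ex G).

Lemma del_edge_subproof (G : graph) (e0 : {set T}) e :
  e \in edges G :\ e0 -> e \subset vertices G /\ #|e| = 2.
Proof. by case/setD1P=> _ /edgesP. Qed.

Definition del_edge (G : graph) (e : {set T}) : graph :=
  Graph (@del_edge_subproof G e).

Definition subgraph (H G : graph) : bool :=
  (vertices H \subset vertices G) && (edges H \subset edges G).

Definition proper_subgraph (H G : graph) : bool :=
  subgraph H G && ((vertices H != vertices G) || (edges H != edges G)).

(* The two clauses are equivalent for graphs without isolated vertices; the   *)
(* second one also covers the deletion of vertices.                           *)
Definition edge_critical (G : graph) : Prop :=
  (forall e, e \in edges G ->
     chromatic_number (del_edge G e) < chromatic_number G) /\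
  (forall H, proper_subgraph H G -> chromatic_number H < chromatic_number G).

End Graphs.

(* The element i of [n] = {1, ..., n} is represented by the ordinal of 'I_n   *)
(* whose value is i - 1; label recovers i, which matters because the size     *)
(* conditions below compare cardinals with elements of [n].                   *)
Definition label (n : nat) (i : 'I_n) : nat := i.+1.

Definition cycle_adj (n : nat) (i j : 'I_n) : bool :=
  (j == ordS i) || (i == ordS j).

Definition interval (n : nat) (a b : 'I_n) : {set 'I_n} :=
  [set x : 'I_n | if a <= b then a <= x <= b else (a <= x) || (x <= b)].

Definition SG_vertices (n k : nat) : {set {set 'I_n}} :=
  [set A : {set 'I_n} | (#|A| == k) &&
     [forall x in A, forall y in A, ~~ cycle_adj x y]].

(* Requiring A != B only matters for k = 0, where it excludes a loop.         *)
Definition SG_edges (n k : nat) : {set {set {set 'I_n}}} :=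
  [set [set A; B] | A in SG_vertices n k, B in SG_vertices n k
                  & (A != B) && [disjoint A & B]].

Lemma SG_edgesP (n k : nat) e :
  e \in SG_edges n k -> e \subset SG_vertices n k /\ #|e| = 2.
Proof.
case/imset2P=> A B VA; rewrite inE => /and3P[VB neqAB _] ->.
by rewrite cards2 neqAB subUset !sub1set VA VB.
Qed.

Definition SG (n k : nat) : graph {set 'I_n} := Graph (@SG_edgesP n k).

Definition interlacing (n : nat) (A B : {set 'I_n}) : bool :=
  [disjoint A & B] &&
  [forall x in A :|: B, forall y in A :|: B,
     [&& x < y & [forall z in A :|: B, ~~ (x < z < y)]] ==>
     ~~ ((x \in A) && (y \in A)) && ~~ ((x \in B) && (y \in B))].

Definition weakly_admissible (n : nat) (A B : {set 'I_n}) (d c : 'I_n) : bool :=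
  (#|interval d c :&: A| == label c) && (#|interval d c :&: B| == label c).

Definition admissible (n : nat) (A B : {set 'I_n}) (d c : 'I_n) : bool :=
  [&& weakly_admissible A B d c, c \notin A :|: B & d \notin A :|: B].

Definition symdiff (T : finType) (X Y : {set T}) : {set T} :=
  (X :\: Y) :|: (Y :\: X).

Definition switch (n : nat) (AB : {set 'I_n} * {set 'I_n}) (dc : 'I_n * 'I_n) :
    {set 'I_n} * {set 'I_n} :=
  let S := interval dc.1 dc.2 :&: (AB.1 :|: AB.2) in
  (symdiff AB.1 S, symdiff AB.2 S).

Definition switch_along (n : nat) (AB : {set 'I_n} * {set 'I_n})
    (s : seq ('I_n * 'I_n)) : {set 'I_n} * {set 'I_n} :=
  foldl (@switch n) AB s.

(* Bounding m by n loses nothing, since c is strictly increasing.             *)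
Definition almost_interlacing (n k : nat) (A B : {set 'I_n}) : bool :=
  [&& A \in SG_vertices n k, B \in SG_vertices n k, [disjoint A & B] &
  [exists m : 'I_n.+1,
   exists c : {ffun 'I_m -> 'I_n}, exists d : {ffun 'I_m -> 'I_n},
   [&& [forall i : 'I_m, forall j : 'I_m, (i < j) ==> (c i < c j)],
       [forall i, 1 <= label (c i) <= k - 1],
       [forall i : 'I_m, forall j : 'I_m, (i < j) ==> (d j < d i)],
       [forall i, k + 1 <= label (d i) <= n],
       [forall i, admissible A B (d i) (c i)] &
       let AB' := switch_along (A, B) [seq (d i, c i) | i <- enum 'I_m] in
       interlacing AB'.1 AB'.2]]].

Definition XG_edges (n k : nat) : {set {set {set 'I_n}}} :=
  [set e in edges (SG n k) |
     [exists A : {set 'I_n}, exists B : {set 'I_n},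
        (e == [set A; B]) && almost_interlacing k A B]].

Lemma XG_edgesP (n k : nat) e :
  e \in XG_edges n k -> e \subset vertices (SG n k) /\ #|e| = 2.
Proof. by rewrite inE => /andP[/edgesP]. Qed.

Definition XG (n k : nat) : graph {set 'I_n} := Graph (@XG_edgesP n k).

(* Main.v *)
Require Import Defs.
From mathcomp Require Import all_boot.
From mathcomp Require Import finmap zify.

(** The obstacle is that being almost-interlacing is a global condition, while both bounds need
    local moves on one end of an edge; the recursion only looks at the start [o] and the last
    elements. Beyond alternation, its one restriction is the gap before the smaller of the two
    largest elements, and this serves both bounds. Every move of the homotopy keeps or creates the
    gap. In the colouring the gap is a free position, whose colour separates the crossed pair
    obtained by exchanging the two last elements. Chains mod 2 are enough for the sphere because
    Fan's argument only counts parities. The colours of the critical colouring are positions: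
    coloured by a position that it contains, a vertex cannot conflict with another one coloured in
    this way, since neighbours are disjoint, and the positions added at one level lie outside the
    range used deeper. *)

(* Let Z be the union of the two ends of an edge of XG(n,k). The labels c_i
   determine the edge among the pairs with union Z, and removing from Z either
   the element 1 and the largest element, or (if 1 is not in Z) the two largest
   elements, gives an edge of XG(n',k-1) shifted by one position. This recursion
   does not involve n, so that XG(n-1,k) is a subgraph of XG(n,k).

   Lower bound: the double cover of XG(n,k) carries a mod 2 sphere of dimension
   n-2k, built by induction on n. Given the sphere of XG(n-1,k), replacing the
   negative vertices by vertices containing n is a homotopy into the bipartite
   graph Gamma(n,k) between vertices avoiding n and vertices containing n; and
   Gamma(n,k) folds onto a copy of Gamma(n-2,k-1) with the sides exchanged,
   hence down to the star Gamma(n-2k+2,1), which is a cone. So the sphere bounds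
   a hemisphere in XG(n,k). By Fan's lemma a colouring with n-2k+1 colours has a
   face of one sign with all colours, whose vertices have a common neighbour.

   Criticality: for an edge e, colour the vertices that meet a set of positions
   near the top of Z (and possibly position 1) by the position they meet, and
   the others by the colouring obtained by induction for the edge of XG(n',k-1)
   that the recursion attaches to e; this isolates e. *)

Set Implicit Arguments.
Unset Strict Implicit.
Unset Printing Implicit Defensive.

(** * Mod 2 chains and box complexes *)

(* A mod 2 chain is a list of faces, a face being a list of vertices. Chains are
   only ever compared through their pairing with all cochains phi, so that the
   boundary is replaced by the coboundary cobd. *)
Definition ev (T : Type) (h : seq (seq T)) (phi : seq T -> bool) : bool :=
  \big[addb/false]_(l <- h) phi l.

Fixpoint cobd (T : Type) (phi : seq T -> bool) (l : seq T) : bool :=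
  if l is x :: l' then phi l' (+) cobd (phi \o cons x) l' else false.

Definition is_cycle (T : Type) (z : seq (seq T)) : Prop :=
  forall phi, ev z (cobd phi) = false.

(* The usual chain homotopy between the identity and the map induced by H. *)
Fixpoint prism (T : Type) (H : T -> T) (l : seq T) : seq (seq T) :=
  if l is x :: l' then (x :: H x :: map H l') :: map (cons x) (prism H l')
  else [::].

Section Chains.

Variable T : Type.
Implicit Types (phi psi : seq T -> bool) (l : seq T) (h z : seq (seq T)).

Lemma ev_cat h1 h2 phi : ev (h1 ++ h2) phi = ev h1 phi (+) ev h2 phi.
Proof. exact: big_cat. Qed.

Lemma eq_ev h phi psi : phi =1 psi -> ev h phi = ev h psi.
Proof. by move=> eqp; apply: eq_bigr => l _. Qed.

Lemma ev_addb h phi psi :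
  ev h (fun l => phi l (+) psi l) = ev h phi (+) ev h psi.
Proof. exact: big_split. Qed.

Lemma ev_flatten (z : seq (seq T)) (P : seq T -> seq (seq T)) phi :
  ev (flatten (map P z)) phi = ev z (fun l => ev (P l) phi).
Proof. by rewrite /ev big_flatten big_map. Qed.

Lemma cobd_eq phi psi : phi =1 psi -> cobd phi =1 cobd psi.
Proof.
move=> eqp l; elim: l phi psi eqp => //= x l IH phi psi eqp.
by rewrite eqp; congr addb; apply: IH => l' /=.
Qed.

Lemma cobd_addb phi psi l :
  cobd (fun l => phi l (+) psi l) l = cobd phi l (+) cobd psi l.
Proof.
elim: l phi psi => //= x l IH phi psi.
by rewrite -!addbA; congr addb; rewrite addbCA; congr addb; apply: IH.
Qed.

Lemma cobd_false l : cobd (fun=> false) l = false.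
Proof. by elim: l => //= x l IH; apply: IH. Qed.

End Chains.

Lemma ev_map (T U : Type) (f : seq T -> seq U) h (phi : seq U -> bool) :
  ev (map f h) phi = ev h (phi \o f).
Proof. exact: big_map. Qed.

Lemma cobd_map (T U : Type) (f : T -> U) (phi : seq U -> bool) l :
  cobd phi (map f l) = cobd (phi \o map f) l.
Proof. by elim: l phi => //= x l IH phi; rewrite IH. Qed.

Lemma is_cycle_map (T U : Type) (f : T -> U) z :
  is_cycle z -> is_cycle (map (map f) z).
Proof.
move=> cz phi; rewrite ev_map -(cz (phi \o map f)).
by apply: eq_ev => l /=; rewrite cobd_map.
Qed.

(** The dual of the homotopy formula: the boundary of a prism is its two ends plus the prism over
    the boundary. Summed over a cycle, the last term vanishes. *)
Lemma cobd_prism (T : Type) (H : T -> T) phi l :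
  ev (prism H l) (cobd phi) =
    phi (map H l) (+) phi l (+) cobd (fun l' => ev (prism H l') phi) l.
Proof.
elim: l phi => [|x l IH] phi; first by rewrite /ev big_nil /= addbb.
have ev_prism l' : ev (prism H (x :: l')) phi =
    phi (x :: H x :: map H l') (+) ev (prism H l') (phi \o cons x).
  by rewrite /ev big_cons big_map.
have -> : ev (prism H (x :: l)) (cobd phi) = cobd phi (x :: H x :: map H l)
    (+) (ev (prism H l) phi (+) ev (prism H l) (cobd (phi \o cons x))).
  by rewrite /ev big_cons big_map -big_split.
rewrite IH /= (cobd_eq ev_prism) cobd_addb cobd_map /=.
rewrite (@cobd_eq _ _ (fun l' => phi (x :: H x :: map H l'))) //.
move: (phi (H x :: _)) (phi (x :: map H l)) (phi (x :: l)) (ev _ phi).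
by move: (cobd _ l) (cobd _ l); do 6!case.
Qed.

Section Good.

Variable V : eqType.
Implicit Types (R : V -> V -> Prop) (l : seq (V * bool)).

Definition flag R l :=
  forall u w, (u, true) \in l -> (w, false) \in l -> R u w.

(* The box complex of R, positive vertices on the left of R: a face is a signed
   set that extends to a flag using both signs. *)
Definition good R l := exists u w, flag R ((u, true) :: (w, false) :: l).

Lemma good_sub R l l' : {subset l' <= l} -> good R l -> good R l'.
Proof.
move=> sub [u [w fl]]; exists u, w => u' w' hu hw.
by apply: fl; move: hu hw; rewrite !inE => hu hw;
  [case/or3P: hu => [->|->|/sub->]|case/or3P: hw => [->|->|/sub->]]; rewrite ?orbT.
Qed.

Lemma good_mono R (R' : V -> V -> Prop) l :
  (forall u w, R u w -> R' u w) -> good R l -> good R' l.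
Proof.
by move=> sRR' [u [w fl]]; exists u, w => u' w' hu hw; apply/sRR'/fl.
Qed.

(** [i] counts vertices, one more than the dimension. The empty face is allowed, so that homology is
    reduced. Faces may repeat vertices, so that every vertex map sends faces of [i] vertices to such
    faces. *)
Definition chain_in R i (z : seq (seq (V * bool))) :=
  forall l, l \in z -> good R l /\ size l = i.

Definition fills R i (z h : seq (seq (V * bool))) :=
  chain_in R i.+1 h /\ forall phi, ev h (cobd phi) = ev z phi.

Definition acyclic R :=
  forall i z, chain_in R i z -> is_cycle z -> exists h, fills R i z h.

Lemma mem_prism (H : V * bool -> V * bool) l p :
  p \in prism H l -> {subset p <= l ++ map H l} /\ size p = (size l).+1.
Proof.
elim: l p => //= x l IH p; rewrite inE => /predU1P[->|/mapP[p' /IH[sub <-] ->]].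
  split=> [y|]; last by rewrite /= size_map.
  by rewrite !inE mem_cat inE => /or3P[->|->|->]; rewrite ?orbT.
split=> // y; rewrite !inE mem_cat inE => /predU1P[->|/sub]; first by rewrite eqxx.
by rewrite mem_cat => /orP[->|->]; rewrite ?orbT.
Qed.

Lemma homotopy R R' (H : V * bool -> V * bool) i z :
    (forall l, good R l -> good R' (l ++ map H l)) ->
    chain_in R i z -> is_cycle z ->
  exists p, chain_in R' i.+1 p /\
    forall phi, ev p (cobd phi) = ev (map (map H) z) phi (+) ev z phi.
Proof.
move=> goodH zR cz; exists (flatten (map (prism H) z)); split=> [p|phi].
  case/flatten_mapP=> l /zR[gl <-] /mem_prism[sub ->]; split=> //.
  exact: good_sub sub (goodH _ gl).
rewrite ev_flatten (eq_ev _ (cobd_prism H phi)) !ev_addb.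
by rewrite cz addbF ev_map.
Qed.

Lemma chain_in_cat R i z z' :
  chain_in R i z -> chain_in R i z' -> chain_in R i (z ++ z').
Proof. by move=> zR z'R l; rewrite mem_cat => /orP[/zR|/z'R]. Qed.

End Good.

Lemma chain_in_map (V W : eqType) R (R' : W -> W -> Prop)
    (F : V * bool -> W * bool) i z :
  (forall l, good R l -> good R' (map F l)) -> chain_in R i z ->
  chain_in R' i (map (map F) z).
Proof. by move=> FR zR _ /mapP[l /zR[gl <-] ->]; rewrite size_map; split; auto. Qed.

(** [G \o F] is homotopic to the identity, so a cycle is filled by the prism of that homotopy
    together with the image under [G] of a filling of its image under [F]. *)
Lemma acyclic_transfer (V W : eqType) (R : V -> V -> Prop) (R' : W -> W -> Prop)
    (F : V * bool -> W * bool) (G : W * bool -> V * bool) :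
    (forall l, good R l -> good R' (map F l)) ->
    (forall l, good R' l -> good R (map G l)) ->
    (forall l, good R l -> good R (l ++ map (G \o F) l)) ->
  acyclic R' -> acyclic R.
Proof.
move=> FR GR GFR acR' i z zR cz.
have [h' [h'R' bh']] := acR' i _ (chain_in_map FR zR) (is_cycle_map F cz).
have [p [pR bp]] := homotopy GFR zR cz.
exists (map (map G) h' ++ p); split=> [|phi].
  by apply: chain_in_cat => //; apply: chain_in_map h'R'.
rewrite ev_cat ev_map bp (eq_ev _ (psi := cobd (phi \o map G))); last first.
  by move=> l /=; rewrite cobd_map.
rewrite bh' !ev_map addbA -[RHS]addFb; congr addb.
rewrite -[RHS](addbb (ev z (phi \o map (G \o F)))).
by congr addb; apply: eq_ev => l /=; rewrite map_comp.
Qed.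

Lemma good_map (V W : eqType) (R : V -> V -> Prop) (R' : W -> W -> Prop)
    (F : V * bool -> W * bool) l :
    (forall x, (F x).2 = x.2) ->
    (forall u w, R u w -> R' (F (u, true)).1 (F (w, false)).1) ->
  good R l -> good R' (map F l).
Proof.
move=> F2 RR' [u [w fl]]; exists (F (u, true)).1, (F (w, false)).1.
have FE v b : ((F (v, b)).1, b) = F (v, b).
  by have := F2 (v, b); case: (F (v, b)) => a c /= ->.
rewrite !FE -[_ :: _ :: _]/(map F ((u, true) :: (w, false) :: l)).
move=> u' w' /mapP[[v b] vl ev] /mapP[[v' b'] v'l ev'].
have := F2 (v', b'); have := F2 (v, b); rewrite -ev -ev' /= => be be'; subst b b'.
by have := RR' _ _ (fl _ _ vl v'l); rewrite -ev -ev'.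
Qed.

Lemma good_map_swap (V W : eqType) (R : V -> V -> Prop) (R' : W -> W -> Prop)
    (F : V * bool -> W * bool) l :
    (forall x, (F x).2 = ~~ x.2) ->
    (forall u w, R u w -> R' (F (w, false)).1 (F (u, true)).1) ->
  good R l -> good R' (map F l).
Proof.
move=> F2 RR' [u [w fl]]; exists (F (w, false)).1, (F (u, true)).1.
have FE v b : ((F (v, b)).1, ~~ b) = F (v, b).
  by have := F2 (v, b); case: (F (v, b)) => a c /= ->.
rewrite (FE w false) (FE u true).
rewrite -[_ :: _ :: _]/(map F ((w, false) :: (u, true) :: l)).
move=> u' w' /mapP[[v b] vl ev] /mapP[[v' b'] v'l ev'].
have := F2 (v', b'); have := F2 (v, b); rewrite -ev -ev' /=.
case: b b' vl v'l ev ev' => [] [] // vl v'l ev ev' _ _.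
have := RR' v' v; rewrite -ev -ev' /=; apply; apply: fl.
  by move: v'l; rewrite !inE orbCA.
by move: vl; rewrite !inE orbCA.
Qed.

(** The face [l ++ map H l] mixes old and new vertices, hence four relations: either end of an edge
    may have moved or not. *)
Lemma good_homotopy (V : eqType) (R R' : V -> V -> Prop)
    (H : V * bool -> V * bool) l :
    (forall x, (H x).2 = x.2) ->
    (forall u w, R u w -> [/\ R' u w, R' (H (u, true)).1 w, R' u (H (w, false)).1
       & R' (H (u, true)).1 (H (w, false)).1]) ->
  good R l -> good R' (l ++ map H l).
Proof.
move=> H2 RH [u [w fl]]; exists u, w.
have inH L v b : (v, b) \in map H L ->
    exists2 v', (v', b) \in L & v = (H (v', b)).1.
  case/mapP=> [[v' b'] v'L e]; have := H2 (v', b'); rewrite -e /= => ->.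
  by exists v'; rewrite // -e.
have {}fl : flag R' (((u, true) :: (w, false) :: l) ++
    map H ((u, true) :: (w, false) :: l)).
  move: fl; move: (_ :: _ :: l) => L fl u' w'; rewrite !mem_cat.
  case/orP=> [ul|/inH[{}u' ul ->]] /orP[wl|/inH[{}w' wl ->]];
    by have := fl _ _ ul wl => // /RH[].
move=> u' w' hu hw; apply: fl; rewrite mem_cat.
  by move: hu; rewrite !inE mem_cat => /or4P[]->; rewrite ?orbT.
by move: hw; rewrite !inE mem_cat => /or4P[]->; rewrite ?orbT.
Qed.

(** * Fan's lemma *)

Definition flip (T : Type) (x : T * bool) : T * bool := (x.1, ~~ x.2).

(** The sign only breaks ties between equal colours; this makes the sorted list unique and [fan]
    invariant under permutation. *)
Definition lex_le (x y : nat * bool) : bool :=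
  (x.1 < y.1) || (x.1 == y.1) && (x.2 ==> y.2).

Lemma lex_le_total : total lex_le.
Proof. by move=> [x []] [y []]; rewrite /lex_le /=; lia. Qed.

Lemma lex_le_trans : transitive lex_le.
Proof. by move=> [x []] [y []] [z []]; rewrite /lex_le /=; lia. Qed.

Lemma lex_le_anti : antisymmetric lex_le.
Proof.
move=> [x b] [y b']; rewrite /lex_le /= => h.
by have [-> ->] : x = y /\ b = b' by split; case: b b' h => [] []; lia.
Qed.

Lemma perm_sort_lex l l' : perm_eq l l' -> sort lex_le l = sort lex_le l'.
Proof. by move/(perm_sortP lex_le_total lex_le_trans lex_le_anti). Qed.

Fixpoint alternates s (l : seq (nat * bool)) : bool :=
  if l is x :: l' then (x.2 == s) && alternates (~~ s) l' else true.

Definition fan s l := alternates s (sort lex_le l).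

Lemma cobd_andb (T : Type) b (phi : seq T -> bool) l :
  cobd (fun l' => b && phi l') l = b && cobd phi l.
Proof. by case: b => //; apply: cobd_false. Qed.

(** A nonempty alternating list has exactly one deletion that leaves a list alternating from [s]:
    its last entry if it starts with [s], its first otherwise. In a list that does not alternate
    such deletions come in pairs, one for each of two equal neighbouring signs. *)
Lemma cobd_alternates s l :
  cobd (alternates s) l = alternates true l (+) alternates false l.
Proof.
elim: l s => //= x l IH s.
rewrite -[cobd _ l]/(cobd (fun l' => (x.2 == s) && alternates (~~ s) l') l).
rewrite cobd_andb IH; case: s x.2 => [] [] /=.
all: by case: (alternates true l); case: (alternates false l).
Qed.

(** [cobd] deletes positions and [rem] first occurrences, which agree up to permutation. This allows
    a face to be sorted before its coboundary is taken. *)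
Lemma cobd_perm (T : eqType) (phi : seq T -> bool) l :
    (forall l1 l2, perm_eq l1 l2 -> phi l1 = phi l2) ->
  cobd phi l = \big[addb/false]_(x <- l) phi (rem x l).
Proof.
elim: l phi => [|x l IH] phi phiP; first by rewrite big_nil.
rewrite big_cons /= eqxx; congr addb.
rewrite IH => [|l1 l2 p12]; last by apply: phiP; rewrite perm_cons.
rewrite big_seq [RHS]big_seq; apply: eq_bigr => y yl /=; apply: phiP.
by case: eqVneq => [->|//]; rewrite perm_sym perm_to_rem.
Qed.

Lemma cobd_perm_eq (T : eqType) (phi : seq T -> bool) l l' :
    (forall l1 l2, perm_eq l1 l2 -> phi l1 = phi l2) ->
  perm_eq l l' -> cobd phi l = cobd phi l'.
Proof.
move=> phiP pll'; rewrite !cobd_perm // (perm_big _ pll') /=.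
rewrite big_seq [RHS]big_seq; apply: eq_bigr => x xl'; apply: phiP.
have xl : x \in l by rewrite (perm_mem pll').
rewrite -(perm_cons x) -(permPl (perm_to_rem xl)).
by rewrite -(permPr (perm_to_rem xl')).
Qed.

Lemma eq_cobd_in (T : eqType) (phi psi : seq T -> bool) l :
  (forall l', subseq l' l -> phi l' = psi l') -> cobd phi l = cobd psi l.
Proof.
elim: l phi psi => //= x l IH phi psi eqp; congr addb.
  by apply: eqp; apply: subseq_cons.
by apply: IH => l' sl'l /=; apply: eqp; rewrite /= eqxx.
Qed.

Lemma cobd_fan s l : cobd (fan s) l = fan true l (+) fan false l.
Proof.
rewrite /fan -(cobd_alternates s).
rewrite (@cobd_perm_eq _ (fan s) l (sort lex_le l)); first last.
- by rewrite perm_sym perm_sort.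
- by move=> l1 l2 /perm_sort_lex; rewrite /fan => ->.
apply: eq_cobd_in => l' sl'; rewrite /fan sorted_sort //; first exact: lex_le_trans.
exact: (subseq_sorted lex_le_trans sl') (sort_sorted lex_le_total l).
Qed.

Lemma alternates_flip s l : alternates s (map (@flip _) l) = alternates (~~ s) l.
Proof. by elim: l s => //= x l IH s; rewrite IH; case: x.2 s => [] []. Qed.

Definition single_signed (l : seq (nat * bool)) : Prop :=
  forall x y, x \in l -> y \in l -> x.1 = y.1 -> x.2 = y.2.

(** When no colour carries both signs, labels of equal colour are equal, so flipping all signs
    preserves the sorted order. *)
Lemma fan_flip s l : single_signed l -> fan s (map (@flip _) l) = fan (~~ s) l.
Proof.
move=> ssl; rewrite /fan -alternates_flip; congr alternates.
apply: (sorted_eq lex_le_trans lex_le_anti); first exact: sort_sorted lex_le_total _.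
  rewrite sorted_map; apply: (sub_in_sorted (P := mem l) (e := lex_le)) => [x y xl yl||].
  - rewrite /relpre /lex_le /=; have := ssl x y xl yl.
    by case: ltngtP => //= _ ->//; case: y.2.
  - by apply/allP=> x; rewrite mem_sort.
  - exact: sort_sorted lex_le_total _.
by rewrite perm_sort perm_map // perm_sym perm_sort.
Qed.

Lemma alternates_nth s l i : alternates s l -> i < size l ->
  (nth (0, s) l i).2 = s (+) odd i.
Proof.
elim: l s i => //= x l IH s [|i] /andP[/eqP xs al] /=; first by rewrite addbF.
move=> il; rewrite (set_nth_default (0, ~~ s)) // (IH (~~ s)) //.
by case: s {IH xs al} (odd i) => [] [].
Qed.

(** Equal colours would be neighbours in the sorted list with equal signs, against alternation. So
    [d.+1] colours increase strictly within [0..d] and the colour [j] stands at position [j]. *)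
Lemma fan_full s l d : single_signed l -> fan s l -> size l = d.+1 ->
    (forall x, x \in l -> x.1 <= d) ->
  (forall x, x \in l -> x.2 = s (+) odd x.1) /\
  (forall j, j <= d -> exists2 x, x \in l & x.1 = j).
Proof.
rewrite /fan; set L := sort _ _ => ssl aL sl ld.
have memL x : (x \in L) = (x \in l) by rewrite mem_sort.
have sL : size L = d.+1 by rewrite size_sort.
have sortedL : sorted ltn (map fst L).
  have: sorted lex_le L by apply: sort_sorted lex_le_total _.
  have ssL x y : x \in L -> y \in L -> x.1 = y.1 -> x.2 = y.2.
    by rewrite !memL; apply: ssl.
  elim: (L) (s) aL ssL => // x [|y L'] IH t //= /and3P[/eqP xt yt aL'] ssL.
  case/andP=> lexy pL; apply/andP; split.
    move: lexy (ssL x y (mem_head _ _)); rewrite /lex_le !inE eqxx orbT => lexy eqxy.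
    case: ltngtP lexy eqxy => //= exy _ /(_ isT exy); rewrite xt (eqP yt).
    by case: (t).
  apply: (IH (~~ t)) => //=; first by rewrite yt.
  by move=> a b al bl; apply: ssL; rewrite inE ?al ?bl orbT.
have iotaL : map fst L = iota 0 d.+1.
  apply: (irr_sorted_eq ltn_trans ltnn) => //; first exact: iota_ltn_sorted.
  have sub : {subset map fst L <= iota 0 d.+1}.
    by move=> _ /mapP[x xL ->]; rewrite mem_iota add0n ltnS ld // -memL.
  apply: (uniq_min_size (sorted_uniq ltn_trans ltnn sortedL) sub _).2.
  by rewrite size_map size_iota sL.
have nthL i x0 : i < d.+1 -> (nth x0 L i).1 = i.
  by move=> id; rewrite -(nth_map _ 0) ?sL // iotaL nth_iota.
split=> [x|j jd]; last by exists (nth (0, s) L j); rewrite ?nthL // -memL mem_nth ?sL.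
rewrite -memL => /(nthP (0, s))[i]; rewrite sL => id <-.
by rewrite nthL // (alternates_nth aL) ?sL.
Qed.

Section FanLemma.

(** [R i] stands for XG(2k+i,k). Each cycle of one graph bounds in the next, which raises the
    dimension of the sphere by one. *)
Variables (V : eqType) (R : nat -> V -> V -> Prop) (c : V -> nat) (d : nat).

Hypothesis symR : forall i u w, R i u w -> R i w u.
Hypothesis edge0 : exists u w, R 0 u w.
Hypothesis fillR : forall i j z, i < d ->
  chain_in (R i) j z -> is_cycle z -> exists h, fills (R i.+1) j z h.
Hypothesis properR : forall i u w, i <= d -> R i u w -> c u <> c w.

(* The sign of a vertex is twisted by the parity of its colour, so that
   alternating faces are those on which the original sign is constant. *)
Definition lab (x : V * bool) : nat * bool := (c x.1, x.2 (+) odd (c x.1)).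

Definition falt s l := fan s (map lab l).

Lemma cobd_falt s l : cobd (falt s) l = falt true l (+) falt false l.
Proof. by rewrite -[LHS]cobd_map cobd_fan. Qed.

Lemma good_flip i l : good (R i) l -> good (R i) (map (@flip V) l).
Proof.
case=> u [w fl]; exists w, u => u' w'; rewrite !inE.
have inf x b : (x, b) \in map (@flip V) l -> (x, ~~ b) \in l.
  by case/mapP=> [[y b'] yl [-> ->]]; rewrite negbK.
by move=> hu hw; apply/symR/fl; rewrite !inE;
  [case/or3P: hw => [/eqP[]//|/eqP[->]|/inf->]
  |case/or3P: hu => [/eqP[->]|/eqP[]//|/inf->]]; rewrite ?eqxx ?orbT.
Qed.

Lemma good_single_signed i l : i <= d -> good (R i) l -> single_signed (map lab l).
Proof.
move=> id [u [w fl]] _ _ /mapP[[x b] xl ->] /mapP[[y b'] yl ->] /= eqc.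
rewrite eqc; congr addb.
have ok p q : (p, true) \in l -> (q, false) \in l -> c p <> c q.
  by move=> pl ql; apply: (properR id); apply: fl; rewrite !inE ?pl ?ql !orbT.
by case: b b' xl yl => [] [] // xl yl; [case: (ok _ _ xl yl)|case: (ok _ _ yl xl)].
Qed.

Lemma falt_flip i s l : i <= d -> good (R i) l ->
  falt s (map (@flip V) l) = falt (~~ s) l.
Proof.
move=> id gl; rewrite /falt -(fan_flip _ (good_single_signed id gl)) -!map_comp.
by congr fan; apply: eq_map => x; rewrite /= /lab /flip /= addNb.
Qed.

(** [h] is a hemisphere of an [i]-sphere, and a filling [h'] of that sphere is the next hemisphere.
    Pairing the boundary of [h'] with [falt true] counts the alternating faces of [h']; on the
    sphere it counts those of [h] starting with true and, through the flip, those starting with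
    false. The parity therefore persists. *)
Lemma tower i : i <= d -> exists h, [/\ chain_in (R i) i.+1 h,
  is_cycle (h ++ map (map (@flip V)) h) & ev h (falt true) (+) ev h (falt false)].
Proof.
elim: i => [|i IH] id.
  have [u [w uw]] := edge0; exists [:: [:: (u, true)]]; split=> [l||].
  - rewrite inE => /eqP->; split=> //; exists u, w => u' w'; rewrite !inE.
    by case/or3P=> /eqP[] // -> /or3P[] /eqP[] // ->.
  - by move=> phi; rewrite /ev !big_cons big_nil /=; case: (phi _).
  - by rewrite /ev !big_cons !big_nil /falt /fan /=; case: (odd _).
have [h [hR ch oh]] := IH (ltnW id).
have zR : chain_in (R i) i.+1 (h ++ map (map (@flip V)) h).
  by apply: chain_in_cat => //; apply: chain_in_map hR; apply: good_flip.
have [h' [h'R bh']] := fillR id zR ch.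
(* The sphere is invariant under [flip], so [h'] and its flip have the same boundary and together
   form a cycle. *)
have flipK phi : ev (map (map (@flip V)) (h ++ map (map (@flip V)) h)) phi =
    ev (h ++ map (map (@flip V)) h) phi.
  rewrite map_cat !ev_cat addbC; congr addb; rewrite -map_comp !ev_map.
  apply: eq_ev => l /=; congr phi; rewrite -map_comp -[RHS]map_id.
  by apply: eq_map => [[x b]] /=; rewrite /flip negbK.
exists h'; split=> // [phi|].
  rewrite ev_cat ev_map bh' -flipK ev_map -(bh' (phi \o map (@flip V))).
  rewrite (eq_ev _ (psi := cobd phi \o map (@flip V))) ?addbb // => l.
  by rewrite /= cobd_map.
rewrite -ev_addb -(eq_ev _ (cobd_falt true)) bh' ev_cat ev_map.
suff -> : ev h (falt true \o map (@flip V)) = ev h (falt false) by [].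
rewrite /ev big_seq [RHS]big_seq; apply: eq_bigr => l /hR[gl _].
exact: (falt_flip _ (ltnW id) gl).
Qed.

(** By the twist in [lab], an alternating face of [d.+1] vertices has a single original sign and
    carries all colours. The vertex of the other sign that extends it is adjacent to all of them, so
    its own colour occurs on a neighbour. *)
Lemma fan_lemma : (forall u w, R d u w -> c u <= d) -> False.
Proof.
move=> cd; have [h [hR _ oh]] := tower (leqnn d).
have [l [s [lh al]]] : exists l s, l \in h /\ falt s l.
  suff /orP[] : has (falt true) h || has (falt false) h.
  - by case/hasP=> l lh al; exists l, true.
  - by case/hasP=> l lh al; exists l, false.
  apply: contraLR oh; rewrite negb_or => /andP[/hasPn ht /hasPn hf].
  rewrite /ev !big1_seq //= => l lh; first exact/negbTE/hf.
  exact/negbTE/ht.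
have [gl sl] := hR l lh.
have [u [w fl]] := gl.
have cl x : x \in map lab l -> x.1 <= d.
  case/mapP=> [[y b] yl ->] /=; case: b yl => yl.
    by apply: (cd y w); apply: fl; rewrite !inE ?yl ?eqxx ?orbT.
  by apply: (cd y u); apply/symR/fl; rewrite !inE ?yl ?eqxx ?orbT.
have [sgn col] := fan_full (good_single_signed (leqnn d) gl) al
  (etrans (size_map _ _) sl) cl.
have uw : R d u w by apply: fl; rewrite !inE eqxx ?orbT.
have sgn_l y b : (y, b) \in l -> b = s.
  by move/(map_f lab)/sgn => /= /(canRL (addbK _)); rewrite addbK.
case: s sgn_l {al sgn} => sgn_l.
  have [_ /mapP[[y b] yl ->] /= cyw] := col _ (cd _ _ (symR uw)).
  have bs := sgn_l _ _ yl; subst b.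
  by apply: (properR (leqnn d)) cyw; apply: fl; rewrite !inE ?yl ?eqxx ?orbT.
have [_ /mapP[[y b] yl ->] /= cyu] := col _ (cd _ _ uw).
have bs := sgn_l _ _ yl; subst b.
by apply: (properR (leqnn d)) (esym cyu); apply: fl; rewrite !inE ?yl ?eqxx ?orbT.
Qed.

End FanLemma.

(** * The edge relation by recursion *)

Local Open Scope fset_scope.
Local Open Scope nat_scope.

Notation nset := {fset nat}.

Implicit Types (A B S X Z : nset) (k o n t u v x y z : nat) (P Q : pred nat).

(* Restated from [inE] at type [nat], where [lia] recognises the atoms. *)
Lemma in_add x a A : (x \in a |` A) = (x == a) || (x \in A).
Proof. by rewrite !inE. Qed.

Lemma in_del x a A : (x \in A `\ a) = (x != a) && (x \in A).
Proof. by rewrite !inE. Qed.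

Lemma nset_ext A B : (forall x : nat, (x \in A) = (x \in B)) -> A = B.
Proof. by move=> eqAB; apply/fsetP. Qed.

Lemma nset_mem A B : A = B -> forall x : nat, (x \in A) = (x \in B).
Proof. by move->. Qed.

Definition in_nset := (in_add, in_del).

(* Edges are described by the letters A, B on the elements of Z = A u B, read
   cyclically from position o (positions count from 0, so label 1 is o = 0 at the
   start of the recursion). If o is in Z, then no cut lies between the largest
   element of Z and o, or between the two largest elements, so that these three
   letters alternate; otherwise the two largest elements have different
   letters, and the cut c = o is available exactly when they are preceded by a
   gap. *)
Inductive wrap_step (P : nset -> nset -> Prop) o : nset -> nset -> Prop :=
  WrapStep A B z of o < z & (forall x, x \in A -> x < z) &
    (forall x, x \in B -> x < z) &
    (forall x, x \in B -> exists2 y : nat, y \in A & x < y) & P A B :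
  wrap_step P o (o |` A) (z |` B).

Inductive tail_step (P : nset -> nset -> Prop) o : nset -> nset -> Prop :=
  TailStep A B u v of o < u & o < v & u != v &
    (forall x, x \in A -> x < minn u v) & (forall x, x \in B -> x < minn u v) &
    (u < v -> u.-1 \notin A) & (v < u -> v.-1 \notin B) & P A B :
  tail_step P o (u |` A) (v |` B).

Fixpoint xedge k o (A B : nset) : Prop :=
  if k is k'.+1 then
    [\/ wrap_step (xedge k' o.+1) o A B, wrap_step (xedge k' o.+1) o B A |
        tail_step (xedge k' o.+1) o A B]
  else A = fset0 /\ B = fset0.

Lemma xedge_inv k o A B : xedge k.+1 o A B ->
  [\/ wrap_step (xedge k o.+1) o A B, wrap_step (xedge k o.+1) o B A |
      tail_step (xedge k o.+1) o A B].
Proof. by []. Qed.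

Lemma xedge_sym k o A B : xedge k o A B -> xedge k o B A.
Proof.
elim: k o A B => [|k IH] o A B /=; first by case.
case; [by constructor 2|by constructor 1|case=> {}A {}B u v *; constructor 3].
by constructor; rewrite // 1?eq_sym 1?minnC //; apply: IH.
Qed.

Lemma xedge_ge k o A B : xedge k o A B ->
  (forall x, x \in A -> o <= x) /\ (forall x, x \in B -> o <= x).
Proof.
elim: k o A B => [|k IH] o A B /=; first by case=> -> ->.
by case=> [[{}A {}B z oz _ _ _]|[{}B {}A z oz _ _ _]|
            [{}A {}B u v ou ov _ _ _ _ _]] /IH[gA gB];
  split=> x; rewrite !in_nset => /predU1P[->|]; try lia; move=> /gA || move=> /gB; lia.
Qed.

Lemma xedge_disj k o A B x : xedge k o A B -> x \in A -> x \notin B.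
Proof.
elim: k o A B => [|k IH] o A B /=; first by case=> ->.
case=> [[{}A {}B z oz lA lB _]|[{}B {}A z oz lB lA _]|
         [{}A {}B u v ou ov uv lA lB _ _]] e;
  have [gA gB] := xedge_ge e; move: (IH _ _ _ e) (lA x) (lB x) (gA x) (gB x);
  by rewrite !in_nset; lia.
Qed.

Lemma xedge_card k o A B : xedge k o A B -> #|`A| = k /\ #|`B| = k.
Proof.
have notin z X : (z \in X -> False) -> z \notin X by move=> h; apply/negP.
elim: k o A B => [|k IH] o A B /=; first by case=> -> ->.
case=> [[{}A {}B z oz lA lB _]|[{}B {}A z oz lB lA _]|
         [{}A {}B u v ou ov uv lA lB _ _]] e;
  have [gA gB] := xedge_ge e; have [cA cB] := IH _ _ _ e;
  rewrite !cardfsU1 cA cB !notin // => h;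
  by first [move: (gA _ h); lia|move: (gB _ h); lia|
            move: (lA _ h); lia|move: (lB _ h); lia].
Qed.

(** The recursion sees the largest element only through comparisons: the gap condition concerns the
    smaller of the last two. *)
Lemma xedge_raise_max k o A B m m' : m < m' ->
    (forall x, x \in A -> x < m) -> (forall x, x \in B -> x < m) ->
  xedge k o A (m |` B) -> xedge k o A (m' |` B).
Proof.
move=> mm'; case: k => [|k] lA lB /=.
  by case=> _ /nset_mem/(_ m); rewrite in_add eqxx.
have mB : m \notin B by apply/negP=> /lB; lia.
move eB1: (m |` B) => B1; case=> [e|e|e].
- case: e lA eB1 => {}A C z oz lA lC lCA e lA1 /nset_mem eq.
  have zm : z = m.
    move: (eq z) (eq m) (lB z) (lC m); rewrite !in_add !eqxx; lia.
  have -> : B = C.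
    apply: nset_ext => x; move: (eq x) (lB x) (lC x); rewrite !in_add zm; lia.
  constructor 1; constructor=> // [|x /lA|x /lC]; lia.
- case: e lA eB1 => C {}A z oz lC lA lAC e lA1 /nset_mem eq.
  by move: (eq m) (lA1 z) (lC m); rewrite !in_add !eqxx /=; lia.
- case: e lA eB1 => {}A C u v ou ov uv lA lC nA nC e lA1 /nset_mem eq.
  have vm : v = m.
    move: (eq v) (eq m) (lB v) (lC m) (lA1 u); rewrite !in_add !eqxx; lia.
  have -> : B = C.
    apply: nset_ext => x; move: (eq x) (lB x) (lC x); rewrite !in_add vm; lia.
  have um : u < m by apply: lA1; rewrite in_add eqxx.
  constructor 3; constructor=> //; try lia.
  + by move=> x /lA; lia.
  + by move=> x /lC; lia.
Qed.

Definition set_max A := \max_(x <- A) x.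

Lemma set_max_add z A : (forall x, x \in A -> x < z) -> set_max (z |` A) = z.
Proof.
move=> lA; rewrite /set_max big_fsetU1 /=; last by apply/negP=> /lA; lia.
apply/maxn_idPl; rewrite big_seq; elim/big_ind: _ => // [x y|x /lA]; lia.
Qed.

Lemma set_max_in A x : x \in A -> set_max A \in A.
Proof.
suff max_in (s : seq nat) : x \in s -> \max_(y <- s) y \in s by exact: max_in.
elim: s x => // a [|b s] IH x _; first by rewrite big_seq1 mem_head.
rewrite big_cons in_cons; case: leqP => _; last by rewrite eqxx.
by rewrite (IH b) ?mem_head ?orbT.
Qed.

Lemma set_max_ge A x : x \in A -> x <= set_max A.
Proof. by move=> xA; apply: leq_bigmax_seq. Qed.

Lemma add_del_max z A : (forall x, x \in A -> x < z) ->
  (z |` A) `\ set_max (z |` A) = A.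
Proof. by move=> lA; rewrite set_max_add // fsetU1K //; apply/negP=> /lA; lia. Qed.

(* The homotopy that moves the negative vertices of the sphere to vertices
   containing t. *)
Definition roll o t B := t |` (if o \in B then B `\ o else B `\ set_max B).

(** If the largest element of the pair is in [B], it is just raised. Otherwise [t] goes behind the
    largest element of [A], giving a tail step. Its gap exists because every other element of [A] is
    followed by one of the old [B] below that largest element. *)
Lemma xedge_roll k o t A B :
    (forall x, x \in A -> x < t) -> (forall x, x \in B -> x < t) ->
  xedge k.+1 o A B -> xedge k.+1 o A (roll o t B).
Proof.
move=> At Bt eAB; case: (eAB) => e; move: eAB; rewrite /roll.
- case: e At Bt => {}A {}B z oz lA lB lBA e At Bt eAB.
  have [_ gB] := xedge_ge e.
  rewrite in_add ifN; last by move: (gB o); lia.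
  rewrite add_del_max //; apply: xedge_raise_max (eAB) => //.
    by apply: Bt; rewrite in_add eqxx.
  by move=> x; rewrite in_add; move: (lA x); lia.
- case: e At Bt => {}B {}A z oz lB lA lAB e At Bt _.
  have [gB _] := xedge_ge e.
  have zt : z < t by apply: At; rewrite in_add eqxx.
  rewrite in_add eqxx /= fsetU1K; last by apply/negP=> /gB; lia.
  constructor 3; constructor=> //; try lia.
  + by move=> x /lA; lia.
  + by move=> x /lB; lia.
  + by move=> _; apply/negP=> /lAB[y /lB]; lia.
  exact: xedge_sym.
- case: e At Bt => {}A {}B u v ou ov uv lA lB nA nB e At Bt eAB.
  have [_ gB] := xedge_ge e.
  have lBv x : x \in B -> x < v by move=> /lB; lia.
  rewrite in_add ifN; last by move: (gB o); lia.
  rewrite add_del_max //.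
  have ut : u < t by apply: At; rewrite in_add eqxx.
  have vt : v < t by apply: Bt; rewrite in_add eqxx.
  have [ltuv|leuv] := ltnP u v.
    by apply: xedge_raise_max (eAB) => // x; rewrite in_add; move: (lA x); lia.
  constructor 3; constructor=> //; try lia.
  + by move=> x /lA; lia.
  + by move=> x /lB; lia.
  + by move=> _; apply/negP=> /lA; lia.
Qed.

(** * The lower bound *)

Lemma xedge_move_max k o A B t :
    (forall x, x \in A -> exists2 y : nat, y \in B & x < y) ->
    set_max B \in B -> set_max B <= t ->
  xedge k o A B -> xedge k o A (t |` (B `\ set_max B)).
Proof.
move=> AB mB; rewrite leq_eqVlt => /predU1P[<-|mt]; rewrite -{1}(fsetD1K mB) //.
apply: xedge_raise_max => // x; first by case/AB=> y /set_max_ge; lia.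
by rewrite in_del => /andP[xm /set_max_ge]; lia.
Qed.

(* The bipartite graph Gamma between sets below n and sets with maximum n. *)
Definition top_edge k o n B A : Prop :=
  [/\ xedge k o B A, n \in A, forall x, x \in B -> x < n
     & forall x, x \in A -> x <= n].

(* The fold of top_edge replaces B by o |` lower_max o n B, which has all the
   neighbours of B. *)
Definition lower_max o n B :=
  if o \in B then n.-1 |` ((B `\ o) `\ set_max (B `\ o))
  else roll o.+1 n.-1 (B `\ set_max B).

(** Without [n], all of [A] is below [n.-1], so [A] becomes the side avoiding the new top: the sides
    are exchanged. If [o] is in [B], the rest of [B] ends beyond the rest of [A] and its maximum can
    be raised to [n.-1]. Otherwise the last elements are the maximum of [B] and [n], and what
    remains of [B] is rolled. *)
Lemma top_edge_down k o n B A : top_edge k.+2 o n B A ->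
  top_edge k.+1 o.+1 n.-1 (A `\ n) (lower_max o n B).
Proof.
case=> e nA lB lA.
suff [e' lA'] : xedge k.+1 o.+1 (A `\ n) (lower_max o n B) /\
    forall x, x \in A `\ n -> x < n.-1.
  split=> // [|x]; rewrite /lower_max /roll; first by case: ifP => _; rewrite in_add eqxx.
  by case: ifP => _; last case: ifP => _; rewrite in_add !in_del;
    move: (lB x); case: (x \in B); lia.
move/xedge_inv: e => e; case: e nA lB lA => [e|e|e].
- case: e => {}B {}A z oz lBz lAz lAB e nA lB lA.
  have zn : z = n.
    by move: nA (lA z) (lAz n); rewrite !in_add eqxx /=; lia.
  have [gB gA] := xedge_ge e.
  have nnA : n \notin A by apply/negP=> /lAz; lia.
  rewrite /lower_max in_add eqxx /= zn !fsetU1K //; last by apply/negP=> /gB; lia.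
  have [y yB] : exists y, y \in B.
    apply/fset0Pn; rewrite -cardfs_gt0; have [-> _] := xedge_card e; lia.
  have mB := set_max_in yB; have mn := lBz _ mB.
  split; last by move=> x /lAB[y' /set_max_ge]; lia.
  by apply: xedge_move_max (xedge_sym e) => //; lia.
- case: e => {}A {}B z oz lAz lBz lBA e nA lB lA.
  by move: nA (lB z) (lAz n); rewrite !in_add eqxx /=; lia.
- case: e => {}B {}A u v ou ov uv lBu lAu _ _ e nA lB lA.
  have un : u < n by apply: lB; rewrite in_add eqxx.
  have vn : v = n by move: nA (lAu n); rewrite !in_add; lia.
  have [gB gA] := xedge_ge e.
  have nnA : n \notin A by apply/negP=> /lAu; lia.
  have lBu' x : x \in B -> x < u by move=> /lBu; lia.
  rewrite /lower_max in_add ifN; last by move: (gB o); lia.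
  rewrite add_del_max // vn fsetU1K //; split; last by move=> x /lAu; lia.
  by apply: xedge_roll (xedge_sym e) => x; [move=> /lAu|move=> /lBu]; lia.
Qed.

Lemma top_edge_up k o n A B : top_edge k.+1 o.+1 n.-1 A B ->
  top_edge k.+2 o n (o |` B) (n |` A).
Proof.
case=> e nB lA lB; have [gA gB] := xedge_ge e.
have on : o.+1 < n by move: (gB _ nB); lia.
split; try by move=> x; rewrite in_add; move: (lA x) (lB x); lia.
  constructor 1; constructor=> //; try lia.
  - by move=> x /lB; lia.
  - by move=> x /lA; lia.
  - by move=> x /lA; exists n.-1.
  - exact: xedge_sym.
by rewrite in_add eqxx.
Qed.

(** In the induction step [G \o F] fixes the sets containing [n] and folds the others. *)
Lemma acyclic_top_edge k o n : acyclic (top_edge k.+1 o n).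
Proof.
elim: k o n => [|k IH] o n.
  have top1 B A : top_edge 1 o n B A -> A = [fset n].
    case=> e nA _ _; have [_ /eqP/cardfs1P[a eA]] := xedge_card e.
    by move: nA; rewrite eA inE => /eqP ->.
  (* The singleton of [n] is the only negative vertex, hence the apex of a cone. *)
  move=> i z zR cz; exists (map (cons ([fset n], false)) z).
  split=> [_ /mapP[l /zR[gl <-] ->]|phi].
    split=> //; case: gl => u [w fl]; exists u, w.
    have <- : w = [fset n] by apply: (top1 u); apply: fl; rewrite !inE eqxx ?orbT.
    have sub : {subset [:: (u, true), (w, false), (w, false) & l] <=
        [:: (u, true), (w, false) & l]}.
      by move=> x; rewrite !inE => /or4P[]->; rewrite ?orbT.
    by move=> u' w' /sub hu /sub hw; apply: fl.
  by rewrite ev_map /= (ev_addb z phi) cz addbF.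
pose F (x : nset * bool) :=
  if x.2 then (lower_max o n x.1, false) else (x.1 `\ n, true).
pose G (x : nset * bool) := if x.2 then (n |` x.1, false) else (o |` x.1, true).
apply: (acyclic_transfer (F := F) (G := G)) (IH o.+1 n.-1) => l.
- apply: good_map_swap => [[B []]|B A] //=; exact: top_edge_down.
- apply: good_map_swap => [[B []]|B A] //=; exact: top_edge_up.
apply: good_homotopy => [[B []]|B A] //= eBA.
have := top_edge_up (top_edge_down eBA).
by case: (eBA) => _ nA _ _; rewrite fsetD1K.
Qed.

Definition edge_below k n B A : Prop :=
  [/\ xedge k 0 B A, forall x, x \in B -> x < n & forall x, x \in A -> x < n].

Lemma top_edge_roll k n B A : edge_below k.+1 n B A ->
  top_edge k.+1 0 n B (roll 0 n A).
Proof.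
case=> e lB lA; split=> //; first exact: xedge_roll.
  by rewrite in_add eqxx.
move=> x; rewrite in_add => /predU1P[->//|].
by case: ifP => _; rewrite in_del => /andP[_ /lA/ltnW].
Qed.

Lemma fill_edge_below k n i (z : seq (seq (nset * bool))) :
    chain_in (edge_below k.+1 n) i z -> is_cycle z ->
  exists h, fills (edge_below k.+1 n.+1) i z h.
Proof.
move=> zR cz.
(* Only negative vertices move. Below, [h] bounds the moved cycle inside [top_edge] and the prism
   [p] joins it to [z]. *)
pose H (x : nset * bool) := if x.2 then x else (roll 0 n x.1, false).
have sub B A : edge_below k.+1 n B A -> edge_below k.+1 n.+1 B A.
  by case=> e lB lA; split=> // x; [move/lB|move/lA]; lia.
have subT B A : top_edge k.+1 0 n B A -> edge_below k.+1 n.+1 B A.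
  by case=> e _ lB lA; split=> // x /lB; lia.
have TH : chain_in (top_edge k.+1 0 n) i (map (map H) z).
  apply: chain_in_map zR => l; apply: good_map => [[B []]|B A] //=; exact: top_edge_roll.
have [h [hR bh]] := acyclic_top_edge TH (is_cycle_map H cz).
have [|p [pR bp]] := homotopy (R' := edge_below k.+1 n.+1) (H := H) _ zR cz.
  move=> l; apply: good_homotopy => [[B []]|B A] //= eBA.
  by have := subT _ _ (top_edge_roll eBA); have := sub _ _ eBA.
exists (h ++ p); split=> [|phi].
  by apply: chain_in_cat => // l /hR[gl sl]; split=> //; apply: good_mono gl.
by rewrite ev_cat bh bp addbA addbb.
Qed.

(** The pair alternates on [2 * k] consecutive positions; the last clause is what the next wrap step
    asks for. *)
Lemma xedge_ex k o : exists A B, [/\ xedge k o A B,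
  forall x, x \in A -> x < o + 2 * k, forall x, x \in B -> x < o + 2 * k
  & forall x, x \in B -> exists2 y : nat, y \in A & x < y].
Proof.
elim: k o => [|k IH] o; first by exists fset0, fset0; split.
have [A [B [e lA lB lBA]]] := IH o.+1.
exists ((o + 2 * k.+1).-1 |` B), (o |` A); split.
- constructor 2; constructor=> // [|x /lA|x /lB]; lia.
- by move=> x; rewrite in_add; move: (lB x); lia.
- by move=> x; rewrite in_add; move: (lA x); lia.
move=> x; rewrite in_add => h; exists (o + 2 * k.+1).-1; rewrite ?in_add ?eqxx //.
by move: h (lA x); lia.
Qed.

Lemma xedge_not_colorable k d (c : nset -> nat) :
    (forall A B, edge_below k.+1 (2 * k.+1 + d) A B -> c A <> c B) ->
    (forall A B, edge_below k.+1 (2 * k.+1 + d) A B -> c A <= d) ->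
  False.
Proof.
move=> properc; apply: (fan_lemma (R := fun i => edge_below k.+1 (2 * k.+1 + i))).
- by move=> i B A [/xedge_sym]; split.
- have [A [B [e lA lB _]]] := xedge_ex k.+1 0.
  by exists A, B; rewrite addn0; split.
- by move=> i j z _ zR cz; rewrite addnS; apply: fill_edge_below.
move=> i A B id [e lA lB]; apply: properc.
by split=> // x; [move/lA|move/lB]; lia.
Qed.

(** * Colourings with a single monochromatic edge *)

(** Two vertices coloured by positions that they contain cannot conflict, as neighbours are
    disjoint; it does not matter which such position is picked. *)
Definition star (g : pred nat) (h : nset -> nat) S : nat :=
  if ohead [seq x <- S | g x] is Some x then x else h S.

Lemma starP (g : pred nat) (h : nset -> nat) S :
  (exists x : nat, [/\ x \in S, g x & star g h S = x]) \/
  ((forall x : nat, x \in S -> ~~ g x) /\ star g h S = h S).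
Proof.
rewrite /star; case E: [seq x <- S | g x] => [|x s] /=; [right|left].
  split=> // x xS; apply/negP=> gx.
  by have: x \in [seq x <- S | g x] by [rewrite mem_filter gx]; rewrite E.
have: x \in [seq x <- S | g x] by rewrite E mem_head.
by rewrite mem_filter => /andP[gx xS]; exists x.
Qed.

Lemma star_eq (g : pred nat) (h : nset -> nat) k o S S' :
    (forall X, ~~ g (h X)) -> xedge k o S S' ->
  star g h S = star g h S' ->
  [/\ forall x : nat, x \in S -> ~~ g x, forall x : nat, x \in S' -> ~~ g x
    & h S = h S'].
Proof.
move=> gh e; case: (starP g h S) => [[x [xS gx ->]]|[nS ->]];
  case: (starP g h S') => [[y [yS gy ->]]|[nS' ->]] //.
- by move=> xy; move: yS; rewrite -xy => xS'; have := xedge_disj e xS; rewrite xS'.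
- by move=> xh; move: (gh S'); rewrite -xh gx.
- by move=> hy; move: (gh S); rewrite hy gy.
Qed.

Definition range lo hi : nset := [fset x in iota lo (hi - lo)].

Lemma in_range lo hi x : (x \in range lo hi) = (lo <= x < hi).
Proof. by rewrite !inE mem_iota; lia. Qed.

Lemma card_range lo hi : #|`range lo hi| = hi - lo.
Proof. by rewrite /range card_fseq undup_id ?iota_uniq // size_iota. Qed.

Lemma in_union x A B : (x \in A `|` B) = (x \in A) || (x \in B).
Proof. by rewrite inE. Qed.

Lemma card_union_disjoint A B : (forall x, x \in A -> x \notin B) ->
  #|`A `|` B| = #|`A| + #|`B|.
Proof.
move=> dAB; rewrite -cardfsUI (_ : A `&` B = fset0) ?cardfs0 ?addn0 //.
by apply: nset_ext => x; rewrite !inE; case: (boolP (x \in A)) => // /dAB /negbTE->.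
Qed.

Lemma card_del x A : x \in A -> #|`A `\ x| = #|`A|.-1.
Proof. by move=> xA; rewrite (cardfsD1 x A) xA. Qed.

(** [K] has [N - o - 2 * k + 1] colours, one fewer than the chromatic number on the [N - o]
    positions from [o] to [N]. The only monochromatic edge allowed is the given one. *)
Definition isolates k o N A0 B0 (f : nset -> nat) (K : nset) :=
  [/\ forall x, x \in K -> o <= x < N, #|`K| + 2 * k = N.+1 - o,
      forall S, f S \in K &
      forall S S', xedge k o S S' -> (forall x, x \in S -> x < N) ->
        (forall x, x \in S' -> x < N) -> f S = f S' ->
        (S = A0 /\ S' = B0) \/ (S = B0 /\ S' = A0)].

Lemma isolates_sym k o N A0 B0 f K :
  isolates k o N A0 B0 f K -> isolates k o N B0 A0 f K.
Proof. by case=> ? ? ? h; split=> // S S' e l l' /(h _ _ e l l') []; auto. Qed.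

Lemma isolates1 o N A0 B0 : xedge 1 o A0 B0 -> (forall x, x \in A0 -> x < N) ->
  (forall x, x \in B0 -> x < N) -> exists f K, isolates 1 o N A0 B0 f K.
Proof.
move=> e lA lB.
have edge1 S S' : xedge 1 o S S' -> exists s t, [/\ S = [fset s], S' = [fset t],
    s != t, o <= s & o <= t].
  move=> e1; have [/eqP/cardfs1P[s eS] /eqP/cardfs1P[t eS']] := xedge_card e1.
  have [gS gS'] := xedge_ge e1; have := xedge_disj (x := s) e1.
  exists s, t; split=> //; [|by apply: gS; rewrite eS inE|by apply: gS'; rewrite eS' inE].
  by move: (xedge_disj (x := s) e1); rewrite eS eS' !inE eqxx => /(_ isT).
have [a [b [eA eB ab oa ob]]] := edge1 _ _ e.
have aN : a < N by apply: lA; rewrite eA inE.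
have bN : b < N by apply: lB; rewrite eB inE.
pose K := range o N `\ b.
have inK x : x \in K = (x != b) && (o <= x < N) by rewrite in_del in_range.
exists (fun S => if S == [fset b] then a else star (fun x => x \in K) (fun=> a) S), K.
have aK : a \in K by rewrite inK ab; lia.
split=> [x| |S|S S' e1 lS lS'].
- by rewrite inK; lia.
- by rewrite card_del ?card_range ?in_range; lia.
- case: ifP => // _.
  by case: (starP (fun x => x \in K) (fun=> a) S) => [[x [_ xK ->]]|[_ ->]].
have [s [t [eS eS' st os ot]]] := edge1 _ _ e1.
have starK r : r \in K -> star (fun x => x \in K) (fun=> a) [fset r] = r.
  move=> rK; case: (starP (fun x => x \in K) (fun=> a) [fset r]) => [[x [xr _ ->]]|[nr _]].
    by move: xr; rewrite inE => /eqP.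
  by move: (nr r); rewrite inE eqxx rK => /(_ isT).
have sN : s < N by apply: lS; rewrite eS inE.
have tN : t < N by apply: lS'; rewrite eS' inE.
rewrite eS eS' eA eB.
have single_eq p q : ([fset p] == [fset q] :> nset) = (p == q).
  apply/eqP/eqP=> [/nset_mem/(_ p)|->//]; by rewrite !inE eqxx => /esym/eqP.
have rK r : r != b -> o <= r -> r < N -> r \in K by rewrite inK => -> -> ->.
rewrite !single_eq; case: eqVneq => [sb|sb]; case: eqVneq => [tb|tb].
- by move: st; rewrite sb tb eqxx.
- by rewrite (starK t) ?rK // => ->; rewrite sb; right.
- by rewrite (starK s) ?rK // => ->; rewrite tb; left.
- by rewrite !starK ?rK // => est; rewrite est eqxx in st.
Qed.

(** Undoes a step of the recursion on one end of an edge without reference to the other end, so that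
    it can serve in a colouring. *)
Definition peel o S := if o \in S then S `\ o else S `\ set_max S.

Lemma peel_first o S : (forall x, x \in S -> o < x) -> peel o (o |` S) = S.
Proof.
by move=> gS; rewrite /peel in_add eqxx fsetU1K //; apply/negP=> /gS; lia.
Qed.

Lemma peel_last o z S : o < z -> (forall x, x \in S -> o < x) ->
  (forall x, x \in S -> x < z) -> peel o (z |` S) = S.
Proof.
move=> oz gS lS; rewrite /peel in_add ifN ?add_del_max //.
by move: (gS o); lia.
Qed.

(** The largest inner element [m] is in [A]. An edge avoiding the star colours has at most the
    position [z] above [m]. A tail step would need two positions above an inner pair reaching [m]. A
    wrap step must end in [z], and its inner pair is not exchanged, since [m] would then need a
    larger element on the other side. *)
Lemma isolates_wrap k o N A B z f K :
    xedge k.+1 o.+1 A B -> o < z < N ->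
    (forall x, x \in A -> x < z) -> (forall x, x \in B -> x < z) ->
    (forall x, x \in B -> exists2 y : nat, y \in A & x < y) ->
    isolates k.+1 o.+1 (set_max A).+1 A B f K ->
  exists f' K', isolates k.+2 o N (o |` A) (z |` B) f' K'.
Proof.
move=> e /andP[oz zN] lA lB lBA [inK cK fK isoK]; set m := set_max A in inK cK isoK.
have [a aA] : exists a, a \in A.
  by apply/fset0Pn; rewrite -cardfs_gt0; have [-> _] := xedge_card e.
have mA : m \in A := set_max_in aA.
have mz : m < z := lA _ mA.
have om : o < m by have [/(_ _ mA)] := xedge_ge e.
have [cA cB] := xedge_card e.
pose g x := (m < x < N) && (x != z).
pose h S := f (peel o S).
pose G := range m.+1 N `\ z.
have inG x : x \in G = g x by rewrite in_del in_range /g andbC.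
have fm S : f S <= m by move: (inK _ (fK S)); lia.
have gh S : ~~ g (h S) by move: (fm (peel o S)); rewrite /g /h; lia.
exists (star g h), (K `|` G); split=> [x| |S|].
- by rewrite in_union inG => /orP[/inK|]; rewrite /g; lia.
- rewrite card_union_disjoint => [|x /inK]; last by rewrite inG /g; lia.
  by rewrite card_del ?in_range ?card_range; lia.
- rewrite in_union; case: (starP g h S) => [[x [_ gx ->]]|[_ ->]].
    by rewrite inG gx orbT.
  by rewrite fK.
have wrap S S' : wrap_step (xedge k.+1 o.+1) o S S' ->
    (forall x, x \in S -> x < N) -> (forall x, x \in S' -> x < N) ->
    star g h S = star g h S' -> S = o |` A /\ S' = z |` B.
  move=> w lS lS' /(star_eq gh (k := k.+2) (Or31 _ _ w))[].
  case: w lS lS' => {}S {}S' z' oz' lSz lSz' lSS' e' lS lS' nS nS'.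
  have [gS gS'] := xedge_ge e'.
  rewrite /h peel_first // peel_last // => eqf.
  have z'm : z' <= m \/ z' = z.
    by move: (nS' z') (lS' z'); rewrite /g in_add eqxx; lia.
  have lm x : x \in S -> x < m.+1.
    by move: (nS x) (lS x) (lSz x); rewrite /g in_add; lia.
  have lm' x : x \in S' -> x < m.+1.
    by move: (nS' x) (lS' x) (lSz' x); rewrite /g in_add; lia.
  case: (isoK _ _ e' lm lm' eqf) => [[eS eS']|[eS eS']].
    have mz' : m < z' by apply: lSz; rewrite eS.
    by rewrite eS eS'; case: z'm => [|->//]; lia.
  by case: (lSS' m); [rewrite eS'|move=> y yS; have := lm _ yS; lia].
move=> S S' /xedge_inv[w|w|t] lS lS' eqf.
- by left; apply: wrap.
- by right; have [] := wrap _ _ w lS' lS (esym eqf).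
case: (star_eq gh (k := k.+2) (Or33 _ _ t) eqf).
case: t lS lS' {eqf} => {}S {}S' u v ou ov uv lSu lSu' _ _ e' lS lS' nS nS'.
have [gS gS'] := xedge_ge e'.
rewrite /h !peel_last //; try by move=> x /lSu || move=> x /lSu'; lia.
move=> eqf.
have lu : u <= m \/ u = z by move: (nS u) (lS u); rewrite /g in_add eqxx; lia.
have lv : v <= m \/ v = z by move: (nS' v) (lS' v); rewrite /g in_add eqxx; lia.
have lm x : x \in S -> x < m.+1.
  by move: (nS x) (lS x) (lSu x); rewrite /g in_add; lia.
have lm' x : x \in S' -> x < m.+1.
  by move: (nS' x) (lS' x) (lSu' x); rewrite /g in_add; lia.
by case: (isoK _ _ e' lm lm' eqf) => [[eS eS']|[eS eS']];
  [move: (lSu m)|move: (lSu' m)]; rewrite ?eS ?eS' mA => /(_ isT); lia.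
Qed.

Lemma tail_notin k o S S' : tail_step (xedge k o.+1) o S S' ->
  o \notin S /\ o \notin S'.
Proof.
case=> {}S {}S' u v ou ov _ _ _ _ _ e; have [gS gS'] := xedge_ge e.
by rewrite !in_add; split; [move: (gS o)|move: (gS' o)]; lia.
Qed.

(** The last two elements can only be [u] and [v]. The first and fourth cases are the wanted edge;
    the other two are the crossed pair, which the callers have to separate. *)
Lemma tail_base k o m u v A B S S' f K :
    isolates k.+1 o.+1 m.+1 A B f K -> m \in A -> m < u -> m < v ->
    tail_step (xedge k.+1 o.+1) o S S' ->
    (forall x, x \in S -> [\/ x <= m, x = u | x = v]) ->
    (forall x, x \in S' -> [\/ x <= m, x = u | x = v]) ->
    f (S `\ set_max S) = f (S' `\ set_max S') ->
  [\/ S = u |` A /\ S' = v |` B, S = v |` A /\ S' = u |` B,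
      S = u |` B /\ S' = v |` A | S = v |` B /\ S' = u |` A].
Proof.
case=> _ _ _ isoK mA mu mv [{}S {}S' p q op oq pq lS lS' _ _ e] inS inS'.
rewrite !add_del_max; try by move=> x /lS || move=> x /lS'; lia.
have puv := inS p; have quv := inS' q; rewrite !in_add !eqxx /= in puv quv.
have {puv quv} [puv quv] := (puv isT, quv isT).
have lm x : x \in S -> x < m.+1.
  move=> xS; move: (lS x xS) (inS x); rewrite in_add xS orbT => ? /(_ isT) [] ?; first lia.
    by case: puv quv => [?|?|?] [?|?|?]; lia.
  by case: puv quv => [?|?|?] [?|?|?]; lia.
have lm' x : x \in S' -> x < m.+1.
  move=> xS; move: (lS' x xS) (inS' x); rewrite in_add xS orbT => ? /(_ isT) [] ?; first lia.
    by case: puv quv => [?|?|?] [?|?|?]; lia.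
  by case: puv quv => [?|?|?] [?|?|?]; lia.
move=> eqf; have {eqf} ABs := isoK _ _ e lm lm' eqf.
have : m < p /\ m < q.
  by case: ABs => [[eS eS']|[eS eS']]; [have := lS m|have := lS' m];
    rewrite ?eS ?eS' mA => /(_ isT); lia.
case: puv quv pq => [?|->|->] [?|->|->] pq [mp mq]; try lia.
  by case: ABs => [[-> ->]|[-> ->]]; [constructor 1|constructor 3].
by case: ABs => [[-> ->]|[-> ->]]; [constructor 2|constructor 4].
Qed.

(** The crossed pair is separated by giving [A] with [v] added the new colour [o], shared with the
    sets containing [o]. There is no conflict: in a wrap step between the two, [m] would have to be
    followed by an element strictly between [m] and [v], but no position there is available when
    [v < u]. *)
Lemma isolates_tail_gt k o N A B m u v f K :
    xedge k.+1 o.+1 A B -> m \in A -> (forall x, x \in A -> x <= m) ->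
    m < v -> v < u -> u < N ->
    isolates k.+1 o.+1 m.+1 A B f K ->
  exists f' K', isolates k.+2 o N (u |` A) (v |` B) f' K'.
Proof.
move=> e mA lA mv vu uN isoK; have [inK cK fK _] := isoK.
have om : o < m by have [/(_ _ mA)] := xedge_ge e.
have [cA cB] := xedge_card e.
pose g x := [&& m < x, x < N, x != u & x != v].
pose h S := if (o \in S) || (S == v |` A) then o else f (S `\ set_max S).
pose G := (range m.+1 N `\ u) `\ v.
have inG x : x \in G = g x by rewrite !in_del in_range /g; lia.
have fm S : o < f S <= m by move: (inK _ (fK S)); lia.
have gh S : ~~ g (h S).
  by rewrite /h /g; case: ifP => _; move: (fm (S `\ set_max S)); lia.
exists (star g h), (o |` (K `|` G)); split=> [x| |S|].
- by rewrite in_add in_union inG => /predU1P[->|/orP[/inK|]]; rewrite /g; lia.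
- have -> : #|`o |` (K `|` G)| = #|`K `|` G|.+1.
    by rewrite cardfsU1 in_union inG /g; case: (boolP (o \in K)) => [/inK|_]; lia.
  rewrite card_union_disjoint => [|x /inK]; last by rewrite inG /g; lia.
  by rewrite !card_del ?in_del ?in_range ?card_range; lia.
- rewrite in_add in_union; case: (starP g h S) => [[x [_ gx ->]]|[_ ->]].
    by rewrite inG gx !orbT.
  by rewrite /h; case: ifP => _; rewrite ?eqxx // fK orbT.
have cover S : (forall x, x \in S -> x < N) -> (forall x, x \in S -> ~~ g x) ->
    forall x, x \in S -> [\/ x <= m, x = u | x = v].
  move=> lS nS x xS; move: (lS x xS) (nS x xS); rewrite /g.
  case: (leqP x m) => [|mx]; first by constructor 1.
  case: (x =P u) => [->|_]; first by constructor 2.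
  by case: (x =P v) => [->|_]; [constructor 3|lia].
have nwrap S S' : wrap_step (xedge k.+1 o.+1) o S S' ->
    (forall x, x \in S -> x < N) -> (forall x, x \in S' -> x < N) ->
    star g h S = star g h S' -> False.
  move=> w lS lS' /(star_eq gh (k := k.+2) (Or31 _ _ w))[nS nS'].
  have {nS nS'} [inS inS'] := (cover _ lS nS, cover _ lS' nS').
  case: w inS inS' {lS lS'} => {}S {}S' z oz lSz lSz' lSS' e' inS inS'.
  have [gS gS'] := xedge_ge e'.
  have oS' : (o \in z |` S') = false by rewrite in_add; move: (gS' o); lia.
  rewrite /h oS' in_add eqxx /=; case: eqP => [eS' _|_ of_]; last first.
    by move: (fm ((z |` S') `\ set_max (z |` S'))); lia.
  have zv : z = v.
    by have := congr1 set_max eS'; rewrite !set_max_add // => x /lA; lia.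
  have [y yS my] : exists2 y : nat, y \in S & m < y.
    apply: lSS'; move: (nset_mem eS' m) (lA v); rewrite !in_add mA orbT; lia.
  have := lSz y yS; have := inS y; rewrite in_add yS orbT => /(_ isT) []; lia.
move=> S S' /xedge_inv[w|w|t] lS lS' eqf.
- by case: (nwrap _ _ w lS lS').
- by case: (nwrap _ _ w lS' lS (esym eqf)).
have [nS nS' eqh] := star_eq gh (k := k.+2) (Or33 _ _ t) eqf.
have {nS nS'} [inS inS'] := (cover _ lS nS, cover _ lS' nS').
have := tail_base isoK mA (ltn_trans mv vu) mv t inS inS'.
have [/negbTE oS /negbTE oS'] := tail_notin t.
move: eqh; rewrite /h oS oS' /=; case: eqP => [eS|nS]; case: eqP => [eS'|nS'].
- have mS : m \in S by rewrite eS in_add mA orbT.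
  have := xedge_disj (k := k.+2) (Or33 _ _ t) mS.
  by rewrite eS' -eS mS.
- by move=> of_; move: (fm (S' `\ set_max S')); lia.
- by move=> of_; move: (fm (S `\ set_max S)); lia.
by move=> eqh /(_ eqh) [[]|[]|[]|[]]; auto.
Qed.

(* Besides u |` A and v |` B, the sets v |` A and u |` B would become a second
   monochromatic edge. Giving v |` A the colour w of the position below u avoids
   this; the sets containing o or w are then coloured crosswise, most of those
   containing w with o and vice versa, to avoid conflicts with v |` A. *)
Lemma isolates_tail_lt k o N A B m u v w f K :
    xedge k.+1 o.+1 A B -> m \in A -> (forall x, x \in A -> x <= m) ->
    u = w.+1 -> m < w -> u < v -> v < N ->
    isolates k.+1 o.+1 m.+1 A B f K ->
  exists f' K', isolates k.+2 o N (u |` A) (v |` B) f' K'.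
Proof.
move=> e mA lA uw mw uv vN isoK; have [inK cK fK _] := isoK.
have om : o < m by have [/(_ _ mA)] := xedge_ge e.
have [cA cB] := xedge_card e.
have wu : w < u by rewrite uw.
pose g x := [&& m < x, x < N, x != u, x != v & x != w].
pose h S :=
  if o \in S then if [|| w \in S, u \in S | v \in S] then o else w
  else if w \in S then if (u \in S) || (v \in S) then w else o
  else if S == v |` A then w else f (S `\ set_max S).
pose G := (range m.+1 N `\ u) `\ v.
have inG x : x \in G = g x || (x == w) by rewrite !in_del in_range /g; lia.
have fm S : o < f S <= m by move: (inK _ (fK S)); lia.
have hV S : [\/ h S = o, h S = w | h S = f (S `\ set_max S)].
  rewrite /h; do 5?case: ifP => _; by [constructor 1|constructor 2|constructor 3].
have gh S : ~~ g (h S).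
  by rewrite /g; case: (hV S) => ->; move: (fm (S `\ set_max S)); lia.
exists (star g h), (o |` (K `|` G)); split=> [x| |S|].
- by rewrite in_add in_union inG => /predU1P[->|/orP[/inK|]]; rewrite /g; lia.
- have -> : #|`o |` (K `|` G)| = #|`K `|` G|.+1.
    by rewrite cardfsU1 in_union inG /g; case: (boolP (o \in K)) => [/inK|_]; lia.
  rewrite card_union_disjoint => [|x /inK]; last by rewrite inG /g; lia.
  by rewrite !card_del ?in_del ?in_range ?card_range; lia.
- rewrite in_add in_union inG; case: (starP g h S) => [[x [_ gx ->]]|[_ ->]].
    by rewrite gx !orbT.
  by case: (hV S) => ->; rewrite ?eqxx ?fK ?orbT.
have cover S : (forall x, x \in S -> x < N) -> (forall x, x \in S -> ~~ g x) ->
    forall x, x \in S -> [|| x <= m, x == u, x == v | x == w].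
  by move=> lS nS x xS; move: (lS x xS) (nS x xS); rewrite /g; lia.
have nwrap S S' : wrap_step (xedge k.+1 o.+1) o S S' ->
    (forall x, x \in S -> x < N) -> (forall x, x \in S' -> x < N) ->
    star g h S = star g h S' -> False.
  move=> st lS lS' eqf.
  have [nS nS' eqh] := star_eq gh (k := k.+2) (Or31 _ _ st) eqf.
  have {nS nS'} [inS inS'] := (cover _ lS nS, cover _ lS' nS').
  have disj x := xedge_disj (k := k.+2) (x := x) (Or31 _ _ st).
  case: st inS inS' disj eqh {lS lS' eqf} => {}S {}S' z oz lSz lSz' lSS' e' inS inS' disj.
  have [gS gS'] := xedge_ge e'.
  have oS' : (o \in z |` S') = false by rewrite in_add; move: (gS' o); lia.
  have oS : o \in o |` S by rewrite in_add eqxx.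
  have zS' : z \in z |` S' by rewrite in_add eqxx.
  rewrite {1}/h oS {1}/h oS'; have [wS'|wS'] := boolP (w \in z |` S').
    (* Equal colours mean that exactly one of the two sets meets [u] or [v]. If it is the one with
       [o], it has an element beyond the last element [z]; if it is the other, nothing can follow
       [w] as the wrap step demands. *)
    have wS : (w \in o |` S) = false by apply/negbTE/negP=> /disj; rewrite wS'.
    rewrite wS /=; case: ifP => [uvS|/norP[uS vS]];
      case: ifP => [uvS'|/norP[uS' vS']] eqc;
      try by move: (ltn_trans om mw); rewrite eqc ltnn.
      have zw : z <= w.
        case/or4P: (inS' z zS') => [zm|/eqP zu|/eqP zv|/eqP-> //].
        - exact: leq_trans zm (ltnW mw).
        - by rewrite -zu zS' in uS'.
        - by rewrite -zv zS' in vS'.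
      have [x [xS xz]] : exists x, x \in o |` S /\ w < x.
        by case/orP: uvS; [exists u|exists v; rewrite (ltn_trans wu)].
      move: xS; rewrite in_add => /predU1P[xo|/lSz xz']; last first.
        by have := leq_trans (ltn_trans xz xz') zw; rewrite ltnn.
      by have := ltn_trans (ltn_trans om mw) xz; rewrite xo ltnn.
    have wS1 : w \in S'.
      move: wS'; rewrite in_add => /predU1P[wz|//].
      have [x [xS xw]] : exists x, x \in z |` S' /\ w < x.
        by case/orP: uvS'; [exists u|exists v; rewrite (ltn_trans wu)].
      move: xS xw; rewrite in_add wz => /predU1P[->|/lSz' xz xw]; first by rewrite ltnn.
      by have := ltn_trans xz xw; rewrite ltnn.
    have [y yS wy] := lSS' w wS1.
    have yS1 : y \in o |` S by rewrite in_add yS orbT.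
    case/or4P: (inS y yS1) => [ym|/eqP yu|/eqP yv|/eqP yw].
    - by have := leq_trans (ltn_trans mw wy) ym; rewrite ltnn.
    - by rewrite -yu yS1 in uS.
    - by rewrite -yv yS1 in vS.
    - by rewrite yw ltnn in wy.
  case: eqP => [eS'|_] eqh; last first.
    by move: eqh (fm ((z |` S') `\ set_max (z |` S'))); case: ifP => _; lia.
  have {eqh} /norP[wS /norP[uS vS]] : ~~ [|| w \in o |` S, u \in o |` S | v \in o |` S].
    by move: eqh; case: ifP => // _; lia.
  have mv : m < v by rewrite (ltn_trans mw) // (ltn_trans wu).
  have zv : z = v.
    have := congr1 set_max eS'; rewrite !set_max_add // => x /lA xm.
    exact: leq_ltn_trans mv.
  have [y yS my] : exists2 y : nat, y \in S & m < y.
    apply: lSS'; move: (nset_mem eS' m).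
    by rewrite !in_add mA orbT zv ltn_eqF.
  have yS1 : y \in o |` S by rewrite in_add yS orbT.
  case/or4P: (inS y yS1) => [ym|/eqP yu|/eqP yv|/eqP yw].
  - by have := leq_trans my ym; rewrite ltnn.
  - by rewrite -yu yS1 in uS.
  - by rewrite -yv yS1 in vS.
  - by rewrite -yw yS1 in wS.
move=> S S' /xedge_inv[st|st|t] lS lS' eqf.
- by case: (nwrap _ _ st lS lS').
- by case: (nwrap _ _ st lS' lS (esym eqf)).
have [nS nS' eqh] := star_eq gh (k := k.+2) (Or33 _ _ t) eqf.
have {nS nS'} [inS inS'] := (cover _ lS nS, cover _ lS' nS').
have wcase T T' : tail_step (xedge k.+1 o.+1) o T T' ->
    (forall x, x \in T -> [|| x <= m, x == u, x == v | x == w]) ->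
    w \in T -> h T = h T' -> False.
  move=> {}t inT wT; have [/negbTE oT /negbTE oT'] := tail_notin t.
  have disj x := xedge_disj (k := k.+2) (x := x) (Or33 _ _ t).
  have /negbTE wT' := disj w wT.
  rewrite /h oT oT' wT wT'; case: eqP => [eT'|_]; last first.
    by move: (fm (T' `\ set_max T')); case: ifP => _; lia.
  case: ifP => [uvT _|_]; last lia.
  have vT' : v \in T' by rewrite eT' in_add eqxx.
  have /negbTE vT : v \notin T by apply/negP=> /disj; rewrite vT'.
  rewrite vT orbF in uvT.
  case: t inT wT vT uvT eT' {oT oT' disj wT' vT'} =>
    {}T {}T' p q op oq pq lT lT' nT _ _ inT wT vT uT eT'.
  have qv : q = v.
    have := congr1 set_max eT'; rewrite !set_max_add // => x; first by move/lA; lia.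
    by move/lT'; lia.
  have pu : p = u.
    move: uT vT (lT u) (inT p); rewrite !in_add eqxx /= => uT vT lu /(_ isT); lia.
  (* The gap condition of the competing edge: [u] and [w], which is [u.-1], cannot both lie in
     [T]. *)
  have : p.-1 \notin T by apply: nT; rewrite pu qv.
  by move: wT; rewrite in_add pu uw /= ltn_eqF //= => ->.
have tsym : tail_step (xedge k.+1 o.+1) o S' S.
  case: (t) => T T' p q *; constructor=> //; rewrite 1?eq_sym 1?minnC //; exact: xedge_sym.
have [wS|wS] := boolP (w \in S); first by case: (wcase _ _ t inS wS eqh).
have [wS'|wS'] := boolP (w \in S'); first by case: (wcase _ _ tsym inS' wS' (esym eqh)).
have cover3 (T : nset) : (forall x, x \in T -> [|| x <= m, x == u, x == v | x == w]) ->
    w \notin T -> forall x, x \in T -> [\/ x <= m, x = u | x = v].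
  move=> inT wT x xT; case/or4P: (inT x xT) => [?|/eqP?|/eqP?|/eqP xw].
  - by constructor 1.
  - by constructor 2.
  - by constructor 3.
  - by rewrite -xw xT in wT.
have mu : m < u by lia.
have := tail_base isoK mA mu (ltn_trans mu uv) t (cover3 _ inS wS) (cover3 _ inS' wS').
have [/negbTE oS /negbTE oS'] := tail_notin t.
move: eqh; rewrite /h oS oS' (negbTE wS) (negbTE wS').
case: eqP => [eS|nS]; case: eqP => [eS'|nS'].
- have mS : m \in S by rewrite eS in_add mA orbT.
  have := xedge_disj (k := k.+2) (Or33 _ _ t) mS.
  by rewrite eS' -eS mS.
- by move=> of_; move: (fm (S' `\ set_max S')); lia.
- by move=> of_; move: (fm (S `\ set_max S)); lia.
by move=> eqh /(_ eqh) [[]|[]|[]|[]]; auto.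
Qed.

Lemma xedge_isolates k o N A B : xedge k.+1 o A B ->
    (forall x, x \in A -> x < N) -> (forall x, x \in B -> x < N) ->
  exists f K, isolates k.+1 o N A B f K.
Proof.
elim: k o N A B => [|k IH] o N A B; first exact: isolates1.
have wrap X Y : wrap_step (xedge k.+1 o.+1) o X Y ->
    (forall x, x \in X -> x < N) -> (forall x, x \in Y -> x < N) ->
    exists f K, isolates k.+2 o N X Y f K.
  case=> {}X {}Y z oz lX lY lYX e lXN lYN.
  have zN : z < N by apply: lYN; rewrite in_add eqxx.
  have [f [K isoK]] : exists f K, isolates k.+1 o.+1 (set_max X).+1 X Y f K.
    by apply: IH => // x; [move/set_max_ge|case/lYX=> y /set_max_ge]; lia.
  by apply: isolates_wrap isoK => //; rewrite oz.
have tail X Y u v m : xedge k.+1 o.+1 X Y -> u < N -> v < N -> u != v ->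
    m \in X -> (forall x, x \in X -> x <= m) -> (forall x, x \in Y -> x <= m) ->
    m < minn u v -> (u < v -> u.-1 \notin X) ->
    exists f K, isolates k.+2 o N (u |` X) (v |` Y) f K.
  move=> e uN vN uv mX lX lY muv nX.
  have [f [K isoK]] : exists f K, isolates k.+1 o.+1 m.+1 X Y f K.
    exact: IH.
  have [ltuv|leuv] := ltnP u v.
    (* By the gap condition [u.-1] lies strictly above the inner pair and can serve as [w]. *)
    have mw : m != u.-1 by apply: contraNneq (nX ltuv) => <-.
    by apply: (isolates_tail_lt (w := u.-1)) isoK => //; lia.
  by apply: isolates_tail_gt isoK => //; lia.
case/xedge_inv=> [e|e|e] lA lB; first exact: wrap.
  by have [f [K /isolates_sym isoK]] := wrap _ _ e lB lA; exists f, K.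
case: e lA lB => {}A {}B u v ou ov uv lA lB nA nB e lAN lBN.
have uN : u < N by apply: lAN; rewrite in_add eqxx.
have vN : v < N by apply: lBN; rewrite in_add eqxx.
have [a aA] : exists a, a \in A.
  by apply/fset0Pn; rewrite -cardfs_gt0; have [-> _] := xedge_card e.
have [b bB] : exists b, b \in B.
  by apply/fset0Pn; rewrite -cardfs_gt0; have [_ ->] := xedge_card e.
have mA := set_max_in aA; have mB := set_max_in bB.
have [ltBA|leAB] := leqP (set_max B) (set_max A).
  apply: (tail _ _ _ _ (set_max A)) => // [x|x|]; try by move/set_max_ge; lia.
  exact: lA.
have [|||||||||f [K /isolates_sym isoK]] := tail B A v u (set_max B); last by exists f, K.
all: rewrite // 1?eq_sym 1?minnC //; try by move=> x /set_max_ge; lia.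
- exact: xedge_sym.
- exact: lB.
Qed.

(** * Cuts and admissible intervals *)

Definition cnt (P : pred nat) A : nat := count P (enum_fset A).

Lemma cnt_add P a A : a \notin A -> cnt P (a |` A) = P a + cnt P A.
Proof.
move=> aA; rewrite /cnt -[RHS]/(count P (a :: enum_fset A)); apply/permP.
apply: uniq_perm => [||x]; rewrite ?fset_uniq //=; first by rewrite aA fset_uniq.
by rewrite in_add inE.
Qed.

Lemma cnt_del P a A : a \in A -> cnt P A = P a + cnt P (A `\ a).
Proof. by move=> aA; rewrite -cnt_add ?fsetD1K // in_del eqxx. Qed.

Lemma cnt_union P A B : (forall x, x \in A -> x \notin B) ->
  cnt P (A `|` B) = cnt P A + cnt P B.
Proof.
move=> dAB; rewrite /cnt -count_cat; apply/permP; apply: uniq_perm => [||x].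
- exact: fset_uniq.
- rewrite cat_uniq !fset_uniq andbT /=; apply/hasPn=> x /= xB.
  by apply/negP=> /dAB; rewrite xB.
- by rewrite in_union mem_cat.
Qed.

Lemma eq_cnt P Q A : (forall x, x \in A -> P x = Q x) -> cnt P A = cnt Q A.
Proof. by move=> eqPQ; apply: eq_in_count. Qed.

Lemma cnt_all P A : (forall x, x \in A -> P x) -> cnt P A = #|`A|.
Proof. by move=> allP_; apply/eqP; rewrite -all_count; apply/allP. Qed.

Lemma cnt_none P A : (forall x, x \in A -> ~~ P x) -> cnt P A = 0.
Proof.
by move=> h; apply/eqP; rewrite -leqn0 leqNgt -has_count; apply/hasPn.
Qed.

Lemma cnt_eq0 P A : cnt P A = 0 -> forall x, x \in A -> ~~ P x.
Proof. by move/eqP; rewrite -leqn0 leqNgt -has_count => /hasPn. Qed.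

Lemma cnt_prefix o c A : (forall x, x \in A -> o <= x) -> c \notin A ->
  cnt (fun x => x <= c) A <= c - o.
Proof.
move=> gA cA; rewrite /cnt -size_filter -[leqRHS](size_iota o).
apply: uniq_leq_size; first by rewrite filter_uniq ?fset_uniq.
move=> x; rewrite mem_filter mem_iota => /andP[xc xA].
have := gA x xA; suff : x != c by lia.
by apply: contraNneq cA => <-.
Qed.

Definition rank Z x : nat := cnt (fun y => y < x) Z.

(* A cut (d, c) stands for the cyclic interval [d, c], which contains 0. *)
Definition inside (p : nat * nat) x : bool := (p.1 <= x) || (x <= p.2).

Definition ncuts (cs : seq (nat * nat)) x : nat := count (fun p => inside p x) cs.

(** Admissibility after [o] steps of the recursion. Each step takes one element of either side out
    of every surviving interval, so the required count, the label [p.2.+1], drops by [o]. *)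
Record cut k o A B (p : nat * nat) : Prop := Cut {
  cut_ge : o <= p.2;
  cut_lt : p.2.+1 < o + k;
  cut_lr : p.2 < p.1;
  cut_notin1 : p.1 \notin A `|` B;
  cut_notin2 : p.2 \notin A `|` B;
  cut_cntl : cnt (inside p) A = p.2.+1 - o;
  cut_cntr : cnt (inside p) B = p.2.+1 - o }.

(* The letters of an interlacing pair alternate along Z, and every cut exchanges
   the letters inside it. *)
Record pattern k o A B (cs : seq (nat * nat)) (s : bool) : Prop := Pattern {
  pat_cardl : #|`A| = k;
  pat_cardr : #|`B| = k;
  pat_disj : forall x, x \in A -> x \notin B;
  pat_ge : forall x, x \in A `|` B -> o <= x;
  pat_cut : forall p, p \in cs -> cut k o A B p;
  pat_in : forall x, x \in A `|` B ->
    (x \in A) = s (+) odd (rank (A `|` B) x) (+) odd (ncuts cs x) }.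

Lemma pattern_sym k o A B cs s : pattern k o A B cs s -> pattern k o B A cs (~~ s).
Proof.
case=> cA cB dAB gAB cutAB inAB; split=> //.
- by move=> x xB; apply/negP=> /dAB; rewrite xB.
- by move=> x; rewrite fsetUC; apply: gAB.
- by move=> p /cutAB[*]; split; rewrite // fsetUC.
move=> x; rewrite fsetUC => xAB; rewrite !addNb -inAB //.
by move: (dAB x) xAB; rewrite in_union; case: (x \in A) => [/(_ isT)/negbTE->|_ /= ->].
Qed.

Definition largest_two Z u v : Prop :=
  [/\ u < v, u \in Z, v \in Z & forall x, x \in Z -> x != u -> x != v -> x < u].

Lemma two_largest Z : 1 < #|`Z| -> exists u v, largest_two Z u v.
Proof.
move=> cZ; have [z zZ] : exists z, z \in Z by apply/fset0Pn; rewrite -cardfs_gt0; lia.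
set v := set_max Z; have vZ : v \in Z := set_max_in zZ.
have [y yZ] : exists y, y \in Z `\ v.
  by apply/fset0Pn; rewrite -cardfs_gt0 card_del //; lia.
have uZ := set_max_in yZ; set u := set_max _ in uZ.
exists u, v; move: uZ; rewrite in_del => /andP[uv uZ]; split=> //.
  by move: (set_max_ge uZ); rewrite -/v; lia.
move=> x xZ xu xv; suff : x <= u by lia.
by apply: set_max_ge; rewrite in_del xv.
Qed.

Lemma rank_largest k Z u v : #|`Z| = 2 * k.+1 -> largest_two Z u v ->
  rank Z u = 2 * k /\ rank Z v = (2 * k).+1.
Proof.
move=> cZ [uv uZ vZ lu].
have uZv : u \in Z `\ v by rewrite in_del uZ andbT ltn_eqF.
have cZ' : #|`(Z `\ v) `\ u| = 2 * k by rewrite !card_del // cZ; lia.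
have lZ' x : x \in (Z `\ v) `\ u -> x < u.
  by rewrite !in_del => /and3P[xu xv xZ]; apply: lu.
rewrite /rank !(cnt_del _ vZ) !(cnt_del _ uZv) uv !ltnn !cnt_all ?cZ' ?ltnNge ?(ltnW uv) //.
by move=> x /lZ' xu; apply: ltn_trans xu uv.
Qed.

(** An interval starting above [u] would contain at most [v] and the positions from [o] to below
    [p.2]: at most [p.2.+1 - o] elements, half the required number. *)
Lemma pattern_cuts k o A B cs s u v p : pattern k o A B cs s ->
  largest_two (A `|` B) u v -> p \in cs -> p.1 < u.
Proof.
move=> [_ _ dAB gAB cutAB _] [uv uZ vZ lu] /cutAB cp.
suff : p.1 <= u.
  by rewrite leq_eqVlt => /predU1P[pu|//]; move: (cut_notin1 cp); rewrite pu uZ.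
rewrite leqNgt; apply/negP=> up.
have := cnt_prefix gAB (cut_notin2 cp).
have := cnt_union (inside p) dAB; rewrite (cut_cntl cp) (cut_cntr cp).
rewrite !(cnt_del _ vZ).
have -> : cnt (inside p) ((A `|` B) `\ v) = cnt (fun x => x <= p.2) ((A `|` B) `\ v).
  apply: eq_cnt => x; rewrite in_del /inside => /andP[xv xZ].
  suff /negbTE-> : ~~ (p.1 <= x) by [].
  rewrite -ltnNge; apply: leq_ltn_trans up.
  by case: (eqVneq x u) => [->//|xu]; apply: ltnW; apply: lu.
move: (cut_ge cp) (cnt _ _) => op c; case: (inside p v); case: (v <= p.2); lia.
Qed.

Lemma ncuts_all k o A B cs s u v x : pattern k o A B cs s ->
  largest_two (A `|` B) u v -> u <= x.+1 -> ncuts cs x = size cs.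
Proof.
move=> pat uv ux; apply/eqP; rewrite -all_count; apply/allP=> p.
by move/(pattern_cuts pat uv) => pu; rewrite /inside -ltnS (leq_trans pu).
Qed.

(** Every interval contains [o], [u.-1], [u] and [v], so the letters at these positions are compared
    through the parity of the rank alone. *)
Lemma pattern_step k o A B cs s u v : pattern k.+1 o A B cs s ->
    largest_two (A `|` B) u v -> u \in A -> v \in B ->
    (forall A' B' cs' s', pattern k o.+1 A' B' cs' s' -> xedge k o.+1 A' B') ->
  xedge k.+1 o A B.
Proof.
move=> pat uvZ uA vB IH; have [cA cB dAB gAB cutAB inAB] := pat.
have [uv uZ vZ lu] := uvZ.
have cZ : #|`A `|` B| = 2 * k.+1 by rewrite card_union_disjoint // cA cB mul2n addnn.
have [ranku rankv] := rank_largest cZ uvZ.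
have cutsu x := ncuts_all (x := x) pat uvZ.
have := inAB u uZ; rewrite uA ranku oddM /= addbF cutsu // => sE.
have ltv x : x \in A `|` B -> x != v -> x < v.
  by move=> xZ xv; case: (eqVneq x u) => [->//|xu]; apply: ltn_trans uv; apply: lu.
have rankE x : rank (A `|` B) x = cnt (fun y => y < x) A + cnt (fun y => y < x) B.
  exact: cnt_union.
have [oA|oA] := boolP (o \in A).
  have eA := fsetD1K oA; have eB := fsetD1K vB.
  set A' := A `\ o in eA; set B' := B `\ v in eB.
  have inA' x : x \in A' -> x != o /\ x \in A by rewrite in_del => /andP.
  have inB' x : x \in B' -> x != v /\ x \in B by rewrite in_del => /andP.
  have dAB' x : x \in A' -> x \notin B'.
    by case/inA' => _ /dAB; apply: contra => /inB'[].
  have gt_o x : x \in A' `|` B' -> o < x.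
    rewrite in_union ltn_neqAle => /orP[/inA'[xo xA]|/inB'[xv xB]].
      by rewrite eq_sym xo gAB // in_union xA.
    rewrite gAB ?in_union ?xB ?orbT // andbT.
    by apply: contraTneq xB => <-; apply: dAB.
  have inZ x : x \in A' `|` B' -> x \in A `|` B /\ x < v.
    rewrite in_union => /orP[/inA'[xo xA]|/inB'[xv xB]].
      have xZ : x \in A `|` B by rewrite in_union xA.
      split=> //; apply: ltv => //; apply: contraTneq xA => ->.
      by apply/negP=> /dAB; rewrite vB.
    by split; last apply: ltv; rewrite // in_union xB orbT.
  rewrite -eA -eB; constructor 1; constructor.
  - by apply: leq_ltn_trans uv; apply: gAB.
  - by move=> x xA; apply: (inZ x _).2; rewrite in_union xA.
  - by move=> x xB; apply: (inZ x _).2; rewrite in_union xB orbT.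
  - move=> x xB; exists u.
      rewrite in_del uA andbT gtn_eqF //.
      have [xv xB1] := inB' _ xB; apply: (@leq_ltn_trans x).
        by apply: gAB; rewrite in_union xB1 orbT.
      apply: lu => //; first by rewrite in_union xB1 orbT.
      by apply: contraTneq xB1 => ->; apply: dAB.
    have [xv xB1] := inB' _ xB; apply: lu => //; first by rewrite in_union xB1 orbT.
    by apply: contraTneq xB1 => ->; apply: dAB.
  (* Removing [o] lowers every remaining rank by one, which exchanges the starting letter. *)
  apply: (IH _ _ cs (~~ s)); split=> //.
  - by rewrite card_del ?cA.
  - by rewrite card_del ?cB.
  - move=> p pcs; have cp := cutAB p pcs; have pu := pattern_cuts pat uvZ pcs.
    have [op pok pl n1 n2 ca cb] := cp.
    have opl : o < p.2.
      rewrite ltn_neqAle op andbT; apply: contraNneq n2 => <-.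
      by rewrite in_union oA.
    split=> //; first by rewrite addSn -addnS.
    + by apply: contra n1 => /inZ[].
    + by apply: contra n2 => /inZ[].
    + by move: ca; rewrite (cnt_del _ oA) /= {1}/inside op orbT subSn // subSS => -[].
    + move: cb; rewrite (cnt_del _ vB) /= {1}/inside (ltnW (ltn_trans pu uv)).
      by rewrite subSn // subSS => -[].
  - move=> x xZ'; have [xZ xv] := inZ x xZ'.
    have -> : (x \in A') = (x \in A) by rewrite in_del gtn_eqF ?gt_o.
    rewrite inAB // rankE (cnt_del _ oA) (cnt_del _ vB) gt_o // ltnNge (ltnW xv) /=.
    by rewrite /rank cnt_union //= !add0n addbN !addNb.
(* An element at [o] would have rank 0, hence the letter of [u], whose rank is even. *)
have oB : o \notin B.
  apply: contra oA => oB; have oZ : o \in A `|` B by rewrite in_union oB orbT.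
  rewrite inAB // rankE !cnt_none /=; last 2 first.
  - by move=> x xB; rewrite -leqNgt gAB // in_union xB orbT.
  - by move=> x xA; rewrite -leqNgt gAB // in_union xA.
  rewrite addbF; suff -> : ncuts cs o = size cs by rewrite -sE.
  apply/eqP; rewrite -all_count.
  by apply/allP=> p /cutAB/cut_ge op; rewrite /inside op orbT.
have eA := fsetD1K uA; have eB := fsetD1K vB.
set A' := A `\ u in eA; set B' := B `\ v in eB.
have inA' x : x \in A' -> x != u /\ x \in A by rewrite in_del => /andP.
have inB' x : x \in B' -> x != v /\ x \in B by rewrite in_del => /andP.
have dAB' x : x \in A' -> x \notin B'.
  by case/inA' => _ /dAB; apply: contra => /inB'[].
have inZ x : x \in A' `|` B' -> x \in A `|` B /\ x < u.
  rewrite in_union => /orP[/inA'[xu xA]|/inB'[xv xB]].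
    have xZ : x \in A `|` B by rewrite in_union xA.
    split=> //; apply: lu => //; apply: contraTneq xA => ->.
    by apply/negP=> /dAB; rewrite vB.
  have xZ : x \in A `|` B by rewrite in_union xB orbT.
  split=> //; apply: lu => //; apply: contraTneq xB => ->; exact: dAB.
have gt_o x : x \in A `|` B -> o < x.
  move=> xZ; rewrite ltn_neqAle gAB // andbT; apply: contraTneq xZ => <-.
  by rewrite in_union negb_or oA.
rewrite -eA -eB; constructor 3; constructor.
- exact: gt_o.
- exact: gt_o.
- by rewrite ltn_eqF.
- by move=> x xA; rewrite (minn_idPl (ltnW uv)); apply: (inZ x _).2; rewrite in_union xA.
- move=> x xB; rewrite (minn_idPl (ltnW uv)); apply: (inZ x _).2.
  by rewrite in_union xB orbT.
- move=> _; apply/negP=> /inA'[mu mA].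
  have um : u.-1.+1 = u by rewrite prednK //; apply: leq_ltn_trans (gt_o u uZ).
  have mZ : u.-1 \in A `|` B by rewrite in_union mA.
  have rankm : rank (A `|` B) u = (rank (A `|` B) u.-1).+1.
    have mltu : u.-1 < u by rewrite -[X in _ < X]um.
    rewrite /rank !(cnt_del _ mZ) mltu ltnn add1n; congr _.+1.
    apply: eq_cnt => y; rewrite in_del => /andP[ym _].
    by move: ym um; clear; lia.
  move: (inAB _ mZ); rewrite mA cutsu ?um //.
  move/(congr1 odd): rankm; rewrite ranku oddM /= => /esym/negbFE->.
  by rewrite addbT addNb -sE.
- by move/ltnW; rewrite leqNgt uv.
(* A cut with [p.2 = o] holds one element of each side, necessarily [u] and [v]. It affects no
   remaining letter and is dropped. *)
apply: (IH _ _ [seq p <- cs | p.2 != o] s); split=> //.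
- by rewrite card_del ?cA.
- by rewrite card_del ?cB.
- by move=> x /inZ[/gt_o].
- move=> p; rewrite mem_filter => /andP[po pcs].
  have [op pok pl n1 n2 ca cb] := cutAB p pcs; have pu := pattern_cuts pat uvZ pcs.
  have opl : o < p.2 by rewrite ltn_neqAle eq_sym po.
  split=> //; first by rewrite addSn -addnS.
  + by apply: contra n1 => /inZ[].
  + by apply: contra n2 => /inZ[].
  + by move: ca; rewrite (cnt_del _ uA) /= {1}/inside (ltnW pu) subSn // subSS => -[].
  + move: cb; rewrite (cnt_del _ vB) /= {1}/inside (ltnW (ltn_trans pu uv)).
    by rewrite subSn // subSS => -[].
move=> x xZ'; have [xZ xu] := inZ x xZ'.
have -> : (x \in A') = (x \in A) by rewrite in_del ltn_eqF.
rewrite inAB // rankE (cnt_del _ uA) (cnt_del _ vB) !ltnNge.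
rewrite (ltnW xu) (ltnW (ltn_trans xu uv)).
rewrite !add0n /rank cnt_union //; congr (_ (+) odd _).
rewrite /ncuts count_filter; apply: eq_in_count => p pcs /=.
case: eqP => [po|_]; last by rewrite andbT.
have [op _ _ _ _ ca cb] := cutAB p pcs; have pu := pattern_cuts pat uvZ pcs.
rewrite andbF; apply/negbTE; move: xZ'; rewrite in_union => /orP[xA'|xB'].
  move: ca; rewrite (cnt_del _ uA) {1}/inside (ltnW pu) po subSnn => -[c0].
  exact: cnt_eq0 c0 _ xA'.
move: cb; rewrite (cnt_del _ vB) {1}/inside (ltnW (ltn_trans pu uv)) po subSnn => -[c0].
exact: cnt_eq0 c0 _ xB'.
Qed.

Lemma pattern_xedge k o A B cs s : pattern k o A B cs s -> xedge k o A B.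
Proof.
elim: k o A B cs s => [|k IH] o A B cs s pat.
  by case: pat => /cardfs0_eq-> /cardfs0_eq->.
have [cA cB dAB gAB cutAB inAB] := pat.
have cZ : #|`A `|` B| = 2 * k.+1 by rewrite card_union_disjoint // cA cB mul2n addnn.
have [|u [v uvZ]] := @two_largest (A `|` B); first by rewrite cZ; lia.
have [uv uZ vZ lu] := uvZ; have [ranku rankv] := rank_largest cZ uvZ.
have := inAB u uZ; have := inAB v vZ; rewrite ranku rankv.
rewrite !(ncuts_all pat uvZ) // 1?ltnW // 1?ltnW // oddS oddM /=.
rewrite addbT addbF addNb => vA uE; rewrite -uE in vA.
case: (boolP (u \in A)) vA => uA vA.
  have vB : v \in B by move: vZ; rewrite in_union vA.
  exact: pattern_step pat uvZ uA vB (IH o.+1).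
have uB : u \in B by move: uZ; rewrite in_union (negbTE uA).
rewrite -/(xedge k.+1 o A B); apply: xedge_sym; rewrite fsetUC in uvZ.
exact: pattern_step (pattern_sym pat) uvZ uB vA (IH o.+1).
Qed.

(** At [o = 0] these give the order of the [c_i] and [d_i] and the bound [k + 1 <= d_i]. By the last
    clause the largest element of the union lies inside every cut. *)
Record ordered_cuts k o A B (cs : seq (nat * nat)) : Prop := OrderedCuts {
  cuts_sorted : sorted (fun p q => (p.2 < q.2) && (q.1 < p.1)) cs;
  cuts_high : forall p, p \in cs -> o + k <= p.1;
  cuts_below : forall p, p \in cs -> exists2 x : nat, x \in A `|` B & p.1 < x }.

Lemma ordered_cuts_sym k o A B cs : ordered_cuts k o A B cs -> ordered_cuts k o B A cs.
Proof. by case=> so hi lo; split=> // p; rewrite fsetUC; apply: lo. Qed.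

Lemma cut_wrap k o A B z p : cut k o.+1 A B p ->
    o < z -> (forall x, x \in A -> o < x) -> z \notin B -> p.1 < z ->
  cut k.+1 o (o |` A) (z |` B) p.
Proof.
case=> op pk pl n1 n2 ca cb oz gA zB pz.
have oA : o \notin A by apply/negP=> /gA; rewrite ltnn.
split=> //.
- exact: ltnW.
- by rewrite addnS -addSn.
- by move: n1; rewrite !(in_add, in_union); lia.
- by move: n2; rewrite !(in_add, in_union); lia.
- by rewrite cnt_add // ca {1}/inside (ltnW op) orbT add1n subSS -subSn // ltnW.
- by rewrite cnt_add // cb {1}/inside (ltnW pz) add1n subSS -subSn // ltnW.
Qed.

Lemma cut_tail k o A B u v p : cut k o.+1 A B p ->
    u \notin A -> v \notin B -> p.1 < minn u v ->
  cut k.+1 o (u |` A) (v |` B) p.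
Proof.
case=> op pk pl n1 n2 ca cb uA vB; rewrite leq_min => /andP[pu pv].
split=> //.
- exact: ltnW.
- by rewrite addnS -addSn.
- by move: n1; rewrite !(in_add, in_union); lia.
- by move: n2; rewrite !(in_add, in_union); lia.
- by rewrite cnt_add // ca {1}/inside (ltnW pu) add1n subSS -subSn // ltnW.
- by rewrite cnt_add // cb {1}/inside (ltnW pv) add1n subSS -subSn // ltnW.
Qed.

Lemma ncuts_size cs x : (forall p, p \in cs -> inside p x) -> ncuts cs x = size cs.
Proof. by move=> h; apply/eqP; rewrite -all_count; apply/allP. Qed.

Lemma rank_all Z x : (forall y, y \in Z -> y < x) -> rank Z x = #|`Z|.
Proof. exact: cnt_all. Qed.

Lemma rank_set_max Z x : x \in Z -> rank Z (set_max Z) = #|`Z|.-1.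
Proof.
move=> xZ; have mZ := set_max_in xZ.
rewrite /rank (cnt_del _ mZ) ltnn cnt_all ?card_del // => y.
by rewrite in_del => /andP[ym /set_max_ge]; rewrite leq_eqVlt (negbTE ym).
Qed.

Definition has_pattern k o A B :=
  exists cs s, pattern k o A B cs s /\ ordered_cuts k o A B cs.

Lemma has_pattern_wrap k o A B z : has_pattern k o.+1 A B -> o < z ->
    (forall x, x \in A -> x < z) -> (forall x, x \in B -> x < z) ->
    (forall x, x \in B -> exists2 y : nat, y \in A & x < y) ->
  has_pattern k.+1 o (o |` A) (z |` B).
Proof.
move=> [cs [s [pat oc]]] oz lA lB lBA.
have [cA cB dAB gAB cutAB inAB] := pat; have [so hi lo] := oc.
have lAB x : x \in A `|` B -> x < z by rewrite in_union => /orP[/lA|/lB].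
have oAB : o \notin A `|` B by apply/negP=> /gAB; rewrite ltnn.
have zAB : z \notin A `|` B by apply/negP=> /lAB; rewrite ltnn.
have [oA oB] : o \notin A /\ o \notin B by apply/andP; rewrite -negb_or -in_union.
have [zA zB] : z \notin A /\ z \notin B by apply/andP; rewrite -negb_or -in_union.
have pz p : p \in cs -> p.1 < z by case/lo=> x /lAB xz /ltn_trans; apply.
have ZE : (o |` A) `|` (z |` B) = o |` (z |` (A `|` B)).
  by apply: nset_ext => x; rewrite !(in_add, in_union) -!orbA; congr (_ || _); exact: orbCA.
have oZ : o \notin z |` (A `|` B) by rewrite in_add negb_or oAB ltn_eqF.
have rankE x : rank ((o |` A) `|` (z |` B)) x = (o < x) + ((z < x) + rank (A `|` B) x).
  by rewrite ZE /rank !cnt_add.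
have cZ : #|`A `|` B| = 2 * k by rewrite card_union_disjoint // cA cB mul2n addnn.
(* This gives [o], of rank 0 and inside all cuts, the letter of [A]. By [sE] it is the opposite of
   [s], unless the inner pair is empty and leaves [s] undetermined. *)
exists cs, (~~ odd (size cs)); split; last first.
  split=> // [p /hi|p /lo[x xAB px]]; first by rewrite addSn addnS.
  by exists x => //; rewrite ZE !in_add xAB !orbT.
have sE x : x \in A `|` B -> odd (size cs) = s.
  move=> xAB; have [a aA] : exists a, a \in A.
    by move: xAB; rewrite in_union => /orP[xA|/lBA[y yA _]]; [exists x|exists y].
  have mAB := set_max_in xAB; set m := set_max _ in mAB.
  have mA : m \in A.
    move: (mAB); rewrite in_union => /orP[//|/lBA[y yA]].
    by rewrite ltnNge set_max_ge // in_union yA.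
  have := inAB m mAB; rewrite mA (rank_set_max xAB) cZ ncuts_size; last first.
    by move=> p /lo[y /set_max_ge ym py]; rewrite /inside (ltnW (leq_trans py ym)).
  have -> : odd (2 * k).-1.
    by case: (k) cZ xAB => [/cardfs0_eq-> //|k' _ _]; rewrite mulnS /= oddM.
  by case: (s) (odd _) => [] [].
split.
- by rewrite cardfsU1 oA cA.
- by rewrite cardfsU1 zB cB.
- move=> x; rewrite !in_add negb_or => /predU1P[->|xA]; first by rewrite ltn_eqF.
  by rewrite dAB // andbT ltn_eqF // lA.
- by move=> x; rewrite ZE !in_add => /or3P[/eqP->|/eqP->|/gAB] //; apply: ltnW.
- move=> p pcs; apply: cut_wrap (cutAB p pcs) _ _ _ (pz p pcs) => // x xA.
  by apply: gAB; rewrite in_union xA.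
move=> x; rewrite rankE ZE !in_add => /or3P[/eqP->|/eqP->|xAB].
- rewrite eqxx ltnn ltnNge (ltnW oz) /= !add0n /rank cnt_none; last first.
    by move=> y /gAB; rewrite -leqNgt => /ltnW.
  rewrite ncuts_size => [|p /cutAB/cut_ge/ltnW op]; last by rewrite /inside op orbT.
  by case: (odd _).
- rewrite gtn_eqF // (negbTE zA) oz ltnn (rank_all lAB) cZ.
  rewrite ncuts_size => [|p /pz/ltnW pz1]; last by rewrite /inside pz1.
  by rewrite /= add0n oddM /=; case: (odd _).
have [ox xz] := (gAB x xAB, lAB x xAB).
rewrite gtn_eqF // ox ltnNge (ltnW xz) /= add0n inAB // -(sE x xAB).
by rewrite addNb addbN !addNb negbK.
Qed.

(** If the largest inner element is in [B], the letters already alternate at [u] and the cuts stay.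
    If it is in [A], the cut [(u.-1, o)] is added: [u.-1] is free by the gap condition, and the
    interval contains only [u] and [v]. *)
Lemma has_pattern_tail k o A B u v : has_pattern k o.+1 A B -> o < u -> u < v ->
    (forall x, x \in A -> x < u) -> (forall x, x \in B -> x < u) -> u.-1 \notin A ->
  has_pattern k.+1 o (u |` A) (v |` B).
Proof.
move=> [cs [s [pat oc]]] ou uv lA lB nA.
have [cA cB dAB gAB cutAB inAB] := pat; have [so hi lo] := oc.
have lAB x : x \in A `|` B -> x < u by rewrite in_union => /orP[/lA|/lB].
have uA : u \notin A by apply/negP=> /lA; rewrite ltnn.
have uB : u \notin B by apply/negP=> /lB; rewrite ltnn.
have vA : v \notin A by apply/negP=> /lA; rewrite ltnNge ltnW.
have vB : v \notin B by apply/negP=> /lB; rewrite ltnNge ltnW.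
have uAB : u \notin A `|` B by rewrite in_union negb_or uA.
have vAB : v \notin A `|` B by rewrite in_union negb_or vA.
have pu p : p \in cs -> p.1 < u by case/lo=> x /lAB xz /ltn_trans; apply.
have ZE : (u |` A) `|` (v |` B) = u |` (v |` (A `|` B)).
  by apply: nset_ext => x; rewrite !(in_add, in_union) -!orbA; congr (_ || _); exact: orbCA.
have uZ : u \notin v |` (A `|` B) by rewrite in_add negb_or uAB ltn_eqF.
have rankE x : rank ((u |` A) `|` (v |` B)) x = (u < x) + ((v < x) + rank (A `|` B) x).
  by rewrite ZE /rank !cnt_add.
have cZ : #|`A `|` B| = 2 * k by rewrite card_union_disjoint // cA cB mul2n addnn.
have dAB' x : x \in u |` A -> x \notin v |` B.
  rewrite !in_add negb_or => /predU1P[->|xA]; first by rewrite ltn_eqF.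
  by rewrite dAB // andbT ltn_eqF // (ltn_trans (lA x xA)).
have gZ x : x \in (u |` A) `|` (v |` B) -> o <= x.
  rewrite ZE !in_add => /or3P[/eqP->|/eqP->|/gAB/ltnW//]; first exact: ltnW.
  exact: ltnW (ltn_trans ou uv).
have cards : #|`u |` A| = k.+1 /\ #|`v |` B| = k.+1 by rewrite !cardfsU1 uA vB cA cB.
have cutZ p : p \in cs -> cut k.+1 o (u |` A) (v |` B) p.
  by move=> pcs; apply: cut_tail (cutAB p pcs) uA vB _; rewrite (minn_idPl (ltnW uv)) pu.
have ncuts_last x : u <= x -> ncuts cs x = size cs.
  by move=> ux; apply: ncuts_size => p /pu pu'; rewrite /inside (leq_trans (ltnW pu')).
have ranku : rank ((u |` A) `|` (v |` B)) u = 2 * k.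
  by rewrite rankE ltnn ltnNge ltnW //= !add0n rank_all.
have rankv : rank ((u |` A) `|` (v |` B)) v = (2 * k).+1.
  by rewrite rankE ltnn uv /= add1n add0n rank_all ?cZ // => y /lAB yu; apply: ltn_trans uv.
(* [t] records whether [cs'] has one cut more than [cs]. *)
have inZ (r t : bool) cs' : (forall x, x \in A `|` B ->
      (x \in A) = r (+) odd (rank (A `|` B) x) (+) odd (ncuts cs x)) ->
    (forall x, x \in A `|` B -> ncuts cs' x = ncuts cs x) ->
    (forall x, u <= x -> odd (ncuts cs' x) = t (+) odd (size cs)) ->
    r (+) t (+) odd (size cs) = true -> forall x, x \in (u |` A) `|` (v |` B) ->
    (x \in u |` A) = r (+) odd (rank ((u |` A) `|` (v |` B)) x) (+) odd (ncuts cs' x).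
  move=> inAB' ncs ncs' sE x; rewrite {1}ZE !in_add => /or3P[/eqP->|/eqP->|xAB].
  - by rewrite eqxx ranku ncs' // oddM addbF addbA sE.
  - rewrite gtn_eqF // (negbTE vA) rankv ncs' ?(ltnW uv) // oddS oddM.
    by rewrite addbT addNb addbA sE.
  have xu := lAB x xAB.
  rewrite ltn_eqF //= inAB' // rankE ncs // !ltnNge (ltnW xu) (ltnW (ltn_trans xu uv)).
  by rewrite !add0n.
have hi' p : p \in cs -> o + k.+1 <= p.1 by move=> /hi; rewrite addSn addnS.
have lo' p : p \in cs -> exists2 x : nat, x \in (u |` A) `|` (v |` B) & p.1 < x.
  by case/lo=> x xAB px; exists x => //; rewrite ZE !in_add xAB !orbT.
have [Z0|/fset0Pn[x0 x0AB]] := eqVneq (A `|` B) fset0.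
  have cs0 : cs = [::].
    by case: (cs) lo => // p cs' /(_ p (mem_head _ _))[x]; rewrite Z0 inE.
  exists cs, true; split; split=> //; try by case: cards.
  by apply: (inZ true false) => // [x|x /ncuts_last->//|]; rewrite ?Z0 ?inE // cs0.
have mAB := set_max_in x0AB; set m := set_max _ in mAB.
have mge x : x \in A `|` B -> x <= m := @set_max_ge _ x.
have mu := lAB m mAB; have om := gAB m mAB.
have k_gt0 : 0 < k by case: (k) cZ x0AB => // /cardfs0_eq->.
have mE : (m \in A) = ~~ (s (+) odd (size cs)).
  rewrite inAB // (rank_set_max x0AB) cZ ncuts_size => [|p /lo[y /mge ym py]]; last first.
    by rewrite /inside (ltnW (leq_trans py ym)).
  have -> : odd (2 * k).-1 by case: (k) k_gt0 => // k' _; rewrite mulnS /= oddM.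
  by rewrite addbT addNb.
have [mA|mA] := boolP (m \in A); last first.
  exists cs, s; split=> //; split=> //; try by case: cards.
  apply: (inZ s false) => // [x ux|]; first by rewrite ncuts_last.
  by move: mE; rewrite (negbTE mA) addbF => /esym/negbFE.
have mu1 : m < u.-1.
  have : m != u.-1 by apply: contraNneq nA => <-.
  by move: mu; clear; lia.
have inside_new x : x \in A `|` B -> inside (u.-1, o) x = false.
  move=> xAB; rewrite /inside /= leqNgt (leq_ltn_trans (mge x xAB)) //=.
  by rewrite leqNgt gAB.
have u1 : u.-1 < u by move: ou; clear; lia.
exists ((u.-1, o) :: cs), s; split; split=> //; try by case: cards.
- move=> p; rewrite inE => /predU1P[->|]; last exact: cutZ.
  split=> //=.
  + by rewrite addnS ltnS -[o.+1]addn1 leq_add2l.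
  + exact: ltn_trans mu1.
  + rewrite ZE !in_add !negb_or !ltn_eqF //; last exact: ltn_trans uv.
    by apply/negP=> /mge; rewrite leqNgt mu1.
  + rewrite ZE !in_add !negb_or !ltn_eqF // ?(ltn_trans ou) //.
    by apply/negP=> /gAB; rewrite ltnn.
  + rewrite cnt_add // {1}/inside /= ltnW // cnt_none ?subSnn // => x xA.
    by rewrite inside_new // in_union xA.
  + rewrite cnt_add // {1}/inside /= ltnW ?(ltn_trans u1) // cnt_none ?subSnn // => x xB.
    by rewrite inside_new // in_union xB orbT.
- apply: (inZ s true) => // [x xAB|x ux|].
  + by rewrite /ncuts /= inside_new.
  + by rewrite /ncuts /= {1}/inside /= (leq_trans (ltnW u1)) //= -/(ncuts cs x) ncuts_last.
  + by move: mE; rewrite mA addbT addNb => <-.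
- rewrite /=; case: (cs) so cutAB lo => //= p cs' so' cut' lo'' /=; rewrite so' andbT.
  have pcs : p \in p :: cs' := mem_head _ _.
  rewrite (cut_ge (cut' p pcs)) /=; have [x /mge xm px] := lo'' p pcs.
  exact: ltn_trans px (leq_ltn_trans xm mu1).
(* The [2 * k] inner elements lie between [o.+1] and [m], which puts [u.-1] beyond [o + 2 * k]. *)
- move=> p; rewrite inE => /predU1P[->|/hi'//] /=.
  have m1AB : m.+1 \notin A `|` B by apply/negP=> /mge; rewrite ltnn.
  have := cnt_prefix gAB m1AB.
  rewrite cnt_all ?cZ => [|x /mge/leqW//].
  by move: mu1 k_gt0; clear; lia.
- move=> p; rewrite inE => /predU1P[->|/lo'//] /=.
  by exists u => //; rewrite ZE in_add eqxx.
Qed.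

Lemma has_pattern_sym k o A B : has_pattern k o A B -> has_pattern k o B A.
Proof.
case=> cs [s [/pattern_sym pat /ordered_cuts_sym oc]]; by exists cs, (~~ s).
Qed.

Lemma xedge_pattern k o A B : xedge k o A B -> has_pattern k o A B.
Proof.
elim: k o A B => [|k IH] o A B.
  by case=> -> ->; exists [::], true; split; split=> // x; rewrite ?in_union inE.
case/xedge_inv; case.
- by move=> {}A {}B z oz lA lB lBA /IH pat; exact: has_pattern_wrap pat oz lA lB lBA.
- move=> {}B {}A z oz lB lA lAB /IH pat; apply: has_pattern_sym.
  exact: has_pattern_wrap pat oz lB lA lAB.
move=> {}A {}B u v ou ov uv lA lB nA nB /IH pat.
have [ltuv|ltvu|euv] := ltngtP u v; last by rewrite euv eqxx in uv.
  rewrite (minn_idPl (ltnW ltuv)) in lA lB.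
  by apply: has_pattern_tail pat _ _ _ _ (nA _).
rewrite (minn_idPr (ltnW ltvu)) in lA lB.
apply: has_pattern_sym.
by apply: (has_pattern_tail (has_pattern_sym pat)) => //; apply: nB.
Qed.

Local Close Scope fset_scope.

(** * Subsets of ['I_n] as finite sets of naturals *)

Section Ordinals.

Variable n : nat.
Implicit Types (U V W : {set 'I_n}) (i j : 'I_n).

Definition to_nset U : nset := [fset val i | i in U]%fset.

Definition of_nset S : {set 'I_n} := [set i : 'I_n | val i \in S].

Lemma mem_to_nset U i : (val i \in to_nset U) = (i \in U).
Proof.
apply/imfsetP/idP => /= [[j jU /val_inj->]//|iU]; by exists i.
Qed.

Lemma to_nsetP U x : x \in to_nset U -> exists2 i, i \in U & x = val i.
Proof. by case/imfsetP => /= i iU ->; exists i. Qed.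

Lemma to_nset_lt U x : x \in to_nset U -> x < n.
Proof. by case/to_nsetP=> i _ ->; apply: ltn_ord. Qed.

Lemma to_nsetK : cancel to_nset of_nset.
Proof. by move=> U; apply/setP=> i; rewrite inE mem_to_nset. Qed.

Lemma of_nsetK S : (forall x, x \in S -> x < n) -> to_nset (of_nset S) = S.
Proof.
move=> lS; apply: nset_ext => x; apply/idP/idP => [/to_nsetP[i]|xS].
  by rewrite inE => iS ->.
by rewrite -[x]/(val (Ordinal (lS x xS))) mem_to_nset inE.
Qed.

Lemma to_nsetU U V : to_nset (U :|: V) = (to_nset U `|` to_nset V)%fset.
Proof.
apply: nset_ext => x; rewrite in_union.
apply/idP/orP => [/to_nsetP[i]|[] /to_nsetP[i iU ->]].
- by rewrite inE => /orP[iU|iU] ->; rewrite !mem_to_nset; [left|right].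
- by rewrite mem_to_nset inE iU.
- by rewrite mem_to_nset inE iU orbT.
Qed.

Lemma cnt_to_nset P U : cnt P (to_nset U) = #|[set i in U | P (val i)]|.
Proof.
rewrite /cnt cardE -(size_map val) -size_filter; apply/perm_size/uniq_perm.
- by rewrite filter_uniq ?fset_uniq.
- by rewrite (map_inj_uniq val_inj) enum_uniq.
move=> x; rewrite mem_filter; apply/andP/mapP => [[Px /to_nsetP[i iU xi]]|[i]].
  by exists i; rewrite // mem_enum inE iU -xi.
by rewrite mem_enum inE => /andP[iU Pi] ->; split; last by rewrite [_ \in _]mem_to_nset.
Qed.

Lemma card_to_nset U : #|`to_nset U|%fset = #|U|.
Proof.
have <- := @cnt_all predT (to_nset U) (fun _ _ => isT).
by rewrite cnt_to_nset; apply: eq_card => i; rewrite inE andbT.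
Qed.

Lemma disjoint_to_nset U V : [disjoint U & V] ->
  forall x, x \in to_nset U -> x \notin to_nset V.
Proof.
move=> dUV x /to_nsetP[i iU ->]; rewrite mem_to_nset.
by rewrite (disjointFr dUV iU).
Qed.

Lemma in_interval (d c : 'I_n) i : c < d ->
  (i \in interval d c) = inside (val d, val c) (val i).
Proof. by move=> cd; rewrite inE leqNgt cd. Qed.

Lemma in_symdiff U V i : (i \in symdiff U V) = (i \in U) (+) (i \in V).
Proof. by rewrite !inE; case: (i \in U); case: (i \in V). Qed.

(** A switch keeps the union and exchanges the letters in its interval, so only the parity of the
    number of intervals at [i] counts, not their order. *)
Lemma switch_alongE U V (s : seq ('I_n * 'I_n)) i : [disjoint U & V] ->
  let cs j := count (fun p => j \in interval p.1 p.2) s in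
  ((i \in (switch_along (U, V) s).1) = (i \in U :|: V) && ((i \in U) (+) odd (cs i))) *
  ((i \in (switch_along (U, V) s).2) = (i \in U :|: V) && ((i \in V) (+) odd (cs i))).
Proof.
elim: s U V => [|p s IH] U V dUV /=.
  by rewrite inE !addbF; case: (i \in U); case: (i \in V).
set S := interval p.1 p.2 :&: (U :|: V).
have d j : (j \in U) && (j \in V) = false.
  by case: (boolP (j \in U)) => // /(disjointFr dUV).
have dUV' : [disjoint symdiff U S & symdiff V S].
  rewrite disjoint_subset; apply/subsetP=> j.
  rewrite [_ \in [predC _]]inE !(in_symdiff, in_setI, in_setU).
  by move: (d j); case: (j \in U); case: (j \in V); case: (j \in interval p.1 p.2).
have UV' : symdiff U S :|: symdiff V S = U :|: V.
  apply/setP=> j; rewrite !(in_symdiff, in_setI, in_setU).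
  by move: (d j); case: (j \in U); case: (j \in V); case: (j \in interval p.1 p.2).
have [e1 e2] := IH _ _ dUV'.
have sE : switch (U, V) p = (symdiff U S, symdiff V S). by [].
rewrite sE e1 e2 UV' !in_symdiff !(in_setI, in_setU).
rewrite oddD oddb; move: (odd (count _ _)) (d i) => c.
by split; case: (i \in U) d; case: (i \in V); case: (i \in interval p.1 p.2); case: c.
Qed.

Definition rank_set U i := #|[set j in U | j < i]|.

Lemma rank_to_nset U i : rank (to_nset U) (val i) = rank_set U i.
Proof. exact: cnt_to_nset. Qed.

Lemma interlacingP U V : reflect
  ([disjoint U & V] /\ exists s, forall i, i \in U :|: V ->
     (i \in U) = s (+) odd (rank_set (U :|: V) i))
  (interlacing U V).
Proof.
have [dUV|] := boolP [disjoint U & V]; last first.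
  by rewrite /interlacing => /negbTE->; constructor; case.
rewrite /interlacing dUV /=; move eZ: (U :|: V) => Z.
have dV i : i \in Z -> (i \in V) = ~~ (i \in U).
  rewrite -eZ inE; case: (boolP (i \in U)) => [/(disjointFr dUV)->//|_ /= ->//].
have rank_succ (i j : 'I_n) : i \in Z -> i < j ->
    (forall l, l \in Z -> ~~ (i < l < j)) ->
    rank_set Z j = (rank_set Z i).+1.
  move=> iZ ij nb; rewrite /rank_set (cardsD1 i) !inE iZ ij add1n; congr _.+1.
  apply: eq_card => l; rewrite !inE.
  have [lZ|] := boolP (l \in Z); last by rewrite andbF.
  have := nb l lZ; rewrite /= -val_eqE /=; lia.
apply: (iffP idP) => [/forall_inP il|[_ [s hs]]]; last first.
  apply/forall_inP=> i iZ; apply/forall_inP=> j jZ; apply/implyP=> /andP[ij /forall_inP nb].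
  rewrite !dV // !hs // (rank_succ i j) //= addbN.
  by case: (_ (+) _).
split=> //; have [Z0|[i0 i0Z]] := set_0Vmem Z.
  by exists true => i; rewrite Z0 inE.
case: (arg_minnP (fun i : 'I_n => val i) i0Z) => m mZ0 mmin; have mZ : m \in Z := mZ0.
exists (m \in U) => i.
have [N] := ubnP (val i); elim: N i => // N IH i iN iZ.
have [im|mi] := leqP i m.
  have -> : i = m by apply/val_inj/eqP; rewrite eqn_leq im mmin.
  rewrite /rank_set (_ : [set j in Z | j < m] = set0) ?cards0 ?addbF //.
  apply/setP=> j; rewrite !inE; case: (boolP (j \in Z)) => //= jZ.
  by rewrite ltnNge mmin.
have mP : (m \in Z) && (m < i) by rewrite mZ.
case: (arg_maxnP (P := fun j => (j \in Z) && (j < i)) (fun j : 'I_n => val j) mP).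
move=> j /andP[jZ ji] jmax.
have nb l : l \in Z -> ~~ (j < l < i).
  move=> lZ; apply/negP=> /andP[jl li]; have := jmax l; rewrite lZ li => /(_ isT) /=.
  by rewrite leqNgt jl.
have := il j jZ; move/forall_inP/(_ i iZ); rewrite ji /=.
have -> : [forall z in Z, ~~ (j < z < i)] by apply/forall_inP.
rewrite /= (rank_succ j i) //= addbN -IH //; last exact: leq_trans ji _.
by rewrite !dV //; case: (i \in U); case: (j \in U).
Qed.

Definition nat_cut (p : 'I_n * 'I_n) : nat * nat := (val p.1, val p.2).

Lemma interlacing_switch U V (s : seq ('I_n * 'I_n)) : [disjoint U & V] ->
    (forall p, p \in s -> p.2 < p.1) ->
  let Z := (to_nset U `|` to_nset V)%fset in
  let UV := switch_along (U, V) s in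
  interlacing UV.1 UV.2 <->
  exists b : bool, forall x, x \in Z ->
    (x \in to_nset U) = b (+) odd (rank Z x) (+) odd (ncuts (map nat_cut s) x).
Proof.
move=> dUV lts Z UV.
have cutsE i : count (fun p => i \in interval p.1 p.2) s =
    ncuts (map nat_cut s) (val i).
  by rewrite /ncuts count_map; apply: eq_in_count => p /lts; apply: in_interval.
have dV i : i \in U :|: V -> (i \in V) = ~~ (i \in U).
  rewrite inE; case: (boolP (i \in U)) => [/(disjointFr dUV)->//|_ /= ->//].
pose flips i := odd (ncuts (map nat_cut s) (val i)).
have [in1 in2] :
  (forall i, (i \in UV.1) = (i \in U :|: V) && ((i \in U) (+) flips i)) /\
  (forall i, (i \in UV.2) = (i \in U :|: V) && ((i \in V) (+) flips i)).
  by split=> i; rewrite /flips -cutsE; have [e1 e2] := switch_alongE s i dUV.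
have UVE : UV.1 :|: UV.2 = U :|: V.
  apply/setP=> i; rewrite in_setU in1 in2.
  case: (boolP (i \in U :|: V)) => //= /dV->; rewrite addNb; exact: orbN.
have dUV' : [disjoint UV.1 & UV.2].
  rewrite disjoint_subset; apply/subsetP=> i; rewrite inE in1 in2 => /andP[iZ].
  by rewrite iZ dV //= addNb => ->.
have ZE : Z = to_nset (U :|: V) by rewrite to_nsetU.
split=> [/interlacingP[_ [b hb]]|[b hb]].
  exists b => x; rewrite ZE => /to_nsetP[i iZ ->].
  rewrite mem_to_nset rank_to_nset; have := hb i; rewrite UVE iZ in1 iZ => /(_ isT) /= <-.
  by rewrite addbK.
apply/interlacingP; split=> //; exists b => i; rewrite UVE => iZ; rewrite in1 iZ /=.
have := hb (val i); rewrite ZE mem_to_nset iZ mem_to_nset rank_to_nset => /(_ isT) ->.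
by rewrite addbK.
Qed.

End Ordinals.

(** * Almost-interlacing pairs are the edges of the recursion *)

Lemma SG_verticesP n k (A : {set 'I_n}) :
  reflect (#|A| = k /\ forall i, i \in A -> ordS i \notin A) (A \in SG_vertices n k).
Proof.
rewrite inE; apply: (iffP andP) => [[/eqP cA /forall_inP sA]|[-> sA]]; split=> //.
  move=> i iA; apply/negP=> siA.
  by have /forall_inP/(_ _ siA) := sA i iA; rewrite /cycle_adj eqxx.
apply/forall_inP=> i iA; apply/forall_inP=> j jA; rewrite /cycle_adj negb_or.
by apply/andP; split; apply/negP=> /eqP e;
  [move: (sA i iA)|move: (sA j jA)]; rewrite -e ?iA ?jA.
Qed.

(** The ends of a cut are outside the union, so no cut separates two adjacent elements; their ranks
    differ by one and so do their letters. Around the end of the cycle the ranks are [2 * k - 1] and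
    0, and all cuts contain both elements. *)
Lemma pattern_stable n k (A B : {set 'I_n}) cs s : 0 < k ->
    pattern k 0 (to_nset A) (to_nset B) cs s ->
    ordered_cuts k 0 (to_nset A) (to_nset B) cs ->
  A \in SG_vertices n k.
Proof.
move=> k_gt0 pat oc; have [cA cB dAB gAB cutAB inAB] := pat; have [_ _ lo] := oc.
apply/SG_verticesP; split=> [|i iA]; first by rewrite -card_to_nset.
set Z := (to_nset A `|` to_nset B)%fset in gAB inAB lo cutAB.
have inZ j : j \in A -> val j \in Z by rewrite in_union mem_to_nset => ->.
have ltZ x : x \in Z -> x < n by rewrite in_union => /orP[] /to_nset_lt.
have cZ : #|`Z|%fset = 2 * k by rewrite card_union_disjoint // cA cB mul2n addnn.
apply/negP=> siA; have := inAB _ (inZ _ siA); have := inAB _ (inZ _ iA).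
rewrite !mem_to_nset iA siA -!addbA.
suff -> : odd (rank Z (ordS i)) (+) odd (ncuts cs (ordS i)) =
    ~~ (odd (rank Z i) (+) odd (ncuts cs i)).
  by rewrite addbN => <-.
have [si|ni] := ltnP i.+1 n.
  have vS : val (ordS i) = i.+1 by rewrite /= modn_small.
  have iZ := inZ i iA; have sZ := inZ _ siA; rewrite vS in sZ.
  rewrite -[ordS i : nat]/(val _) vS.
  have -> : rank Z i.+1 = (rank Z i).+1.
    rewrite /rank !(cnt_del _ iZ) ltnSn ltnn add1n; congr _.+1.
    by apply: eq_cnt => y; rewrite in_del ltnS leq_eqVlt => /andP[/negbTE->].
  have -> : ncuts cs i.+1 = ncuts cs i.
    apply: eq_in_count => p pcs; have cp := cutAB p pcs.
    have n1 := cut_notin1 cp; have n2 := cut_notin2 cp.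
    have p1 : p.1 != i.+1 by apply: contraNneq n1 => ->.
    have p2 : p.2 != i by apply: contraNneq n2 => ->.
    rewrite /inside; move: p1 p2 => /=.
    by move: (nat_of_ord i) p.1 p.2 => a b c; clear; lia.
  by rewrite addNb.
have iE : i.+1 = n by apply/eqP; rewrite eqn_leq ni ltn_ord.
have le_i x : x < n -> x <= i by move=> xn; rewrite -ltnS iE.
have vS : val (ordS i) = 0 by rewrite /= iE modnn.
have sZ := inZ _ siA; rewrite vS in sZ; rewrite -[ordS i : nat]/(val _) vS.
have -> : rank Z 0 = 0 by apply: cnt_none.
have -> : ncuts cs 0 = size cs by apply: ncuts_size => p _; rewrite /inside orbT.
have iZ := inZ i iA.
have -> : rank Z i = (2 * k).-1.
  rewrite /rank (cnt_del _ iZ) ltnn cnt_all ?card_del ?cZ // => y.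
  by rewrite in_del => /andP[yi /ltZ/le_i]; rewrite leq_eqVlt (negbTE yi).
have -> : ncuts cs i = size cs.
  apply: ncuts_size => p /lo[x /ltZ xn px]; rewrite /inside.
  by rewrite le_i // (ltn_trans px xn).
by case: (k) k_gt0 => // k' _; rewrite mulnS /= oddM; case: (odd (size cs)).
Qed.

Lemma xedge_almost n k (A B : {set 'I_n}) : 0 < k ->
  xedge k 0 (to_nset A) (to_nset B) -> almost_interlacing k A B.
Proof.
move=> k_gt0 /xedge_pattern pat; have [cs [s [pat1 oc]]] := pat.
have [cs' [s' [pat2 oc2]]] := has_pattern_sym pat.
have [cA cB dAB gAB cutAB inAB] := pat1; have [so hi lo] := oc.
have dAB' : [disjoint A & B].
  rewrite disjoint_subset; apply/subsetP=> i iA; rewrite inE -mem_to_nset.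
  by apply: dAB; rewrite mem_to_nset.
have ltZ x : x \in (to_nset A `|` to_nset B)%fset -> x < n.
  by rewrite in_union => /orP[] /to_nset_lt.
have p1n p : p \in cs -> p.1 < n by case/lo=> x /ltZ xn px; apply: ltn_trans xn.
have p2n p : p \in cs -> p.2 < n.
  by move=> pcs; apply: ltn_trans (cut_lr (cutAB p pcs)) (p1n p pcs).
have cs_n : size cs < n.+1.
  rewrite ltnS -(size_map snd) -[leqRHS](size_iota 0); apply: uniq_leq_size.
    apply: (sorted_uniq ltn_trans ltnn); rewrite sorted_map.
    by apply: sub_sorted so => p q /andP[].
  by move=> _ /mapP[p /p2n pn ->]; rewrite mem_iota.
have [i0 _] : exists i0 : 'I_n, i0 \in A.
  by apply/card_gt0P; rewrite -card_to_nset cA.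
apply/and4P; split=> //; [exact: pattern_stable pat1 oc|exact: pattern_stable pat2 oc2|].
apply/existsP; exists (Ordinal cs_n); rewrite /=.
(* [i0] is a mere default value, since [p1n] and [p2n] bound all the cuts by [n]. *)
pose c := [ffun i : 'I_(size cs) => insubd i0 (nth (0, 0) cs i).2].
pose d := [ffun i : 'I_(size cs) => insubd i0 (nth (0, 0) cs i).1].
have memcs (i : 'I_(size cs)) : nth (0, 0) cs i \in cs by apply: mem_nth.
have cE i : val (c i) = (nth (0, 0) cs i).2 by rewrite ffunE; apply: insubdK; apply: p2n.
have dE i : val (d i) = (nth (0, 0) cs i).1 by rewrite ffunE; apply: insubdK; apply: p1n.
have soij (i j : 'I_(size cs)) : i < j ->
    ((nth (0, 0) cs i).2 < (nth (0, 0) cs j).2) &&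
    ((nth (0, 0) cs j).1 < (nth (0, 0) cs i).1).
  move=> ij; apply: (sorted_ltn_nth
    (leT := fun p q => (p.2 < q.2) && (q.1 < p.1))) => //; try exact: ltn_ord.
  by move=> q p r /andP[a b] /andP[a' b']; rewrite (ltn_trans a a') (ltn_trans b' b).
apply/existsP; exists c; apply/existsP; exists d; apply/and5P; split.
- apply/forallP=> i; apply/forallP=> j; apply/implyP=> /soij/andP[h _].
  by rewrite -!cE in h.
- apply/forallP=> i; rewrite /label -[c i : nat]/(val _) cE /=.
  by have := cut_lt (cutAB _ (memcs i)); clear; lia.
- apply/forallP=> i; apply/forallP=> j; apply/implyP=> /soij/andP[_ h].
  by rewrite -!dE in h.
- apply/forallP=> i; rewrite /label ltn_ord andbT addn1 ltnS -[d i : nat]/(val _) dE.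
  exact: (hi _ (memcs i)).
have cutE i : nat_cut (d i, c i) = nth (0, 0) cs i.
  rewrite /nat_cut /= -[nat_of_ord (d i)]/(val _) -[nat_of_ord (c i)]/(val _).
  by rewrite cE dE; case: (nth _ _ _).
have lts i : c i < d i.
  rewrite -[nat_of_ord (d i)]/(val _) -[nat_of_ord (c i)]/(val _) cE dE.
  exact: (cut_lr (cutAB _ (memcs i))).
apply/andP; split.
  apply/forallP=> i; have cp := cutAB _ (memcs i); rewrite -cutE in cp.
  have [_ _ _ n1 n2 ca cb] := cp.
  have cardE (U : {set 'I_n}) : #|interval (d i) (c i) :&: U| =
      cnt (inside (nat_cut (d i, c i))) (to_nset U).
    by rewrite cnt_to_nset; apply: eq_card => j; rewrite in_setI in_interval // inE andbC.
  rewrite /admissible /weakly_admissible !cardE ca cb /label subn0 !eqxx /=.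
  by rewrite -to_nsetU !mem_to_nset in n1 n2; rewrite n1 n2.
apply/(interlacing_switch dAB') => [_ /mapP[i _ ->] //=|].
exists s => x xZ; rewrite inAB //; congr (_ (+) _ (+) odd (ncuts _ _)).
rewrite -map_comp (eq_map cutE).
by rewrite (map_comp (nth (0, 0) cs) val) val_enum_ord -/(mkseq _ _) mkseq_nth.
Qed.

Lemma almost_xedge n k (A B : {set 'I_n}) : 0 < k ->
  almost_interlacing k A B -> xedge k 0 (to_nset A) (to_nset B).
Proof.
move=> k_gt0 /and4P[/SG_verticesP[cA _] /SG_verticesP[cB _] dAB].
case/existsP=> m /existsP[c /existsP[d]].
case/and5P=> _ /forallP hc _ /forallP hd /andP[/forallP adm].
have cd i : c i < d i.
  move: (hc i) (hd i); rewrite /label.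
  by move: (nat_of_ord (c i)) (nat_of_ord (d i)) => a b; clear; lia.
case/(interlacing_switch dAB) => [_ /mapP[i _ ->] //=|s hs].
pose cs := map (@nat_cut n) [seq (d i, c i) | i <- enum 'I_m].
apply: (@pattern_xedge _ _ _ _ cs s); split.
- by rewrite card_to_nset.
- by rewrite card_to_nset.
- exact: disjoint_to_nset.
- by [].
- move=> _ /mapP[_ /mapP[i _ ->] ->].
  have /and3P[/andP[/eqP ca /eqP cb] n2 n1] := adm i.
  have cardE (U : {set 'I_n}) : cnt (inside (nat_cut (d i, c i))) (to_nset U) =
      #|interval (d i) (c i) :&: U|.
    by rewrite cnt_to_nset; apply: eq_card => j; rewrite in_setI in_interval // inE andbC.
  split=> //=.
  + by have /andP[_ ck] := hc i; rewrite ?add0n -[X in _ < X](subnK k_gt0) addn1 ltnS.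
  + by rewrite -to_nsetU mem_to_nset.
  + by rewrite -to_nsetU mem_to_nset.
  + by rewrite cardE ca /label subn0.
  + by rewrite cardE cb /label subn0.
- exact: hs.
Qed.

(** * The theorem *)

Lemma set2_eq (T : finType) (a b c d : T) : [set a; b] = [set c; d] ->
  (a = c /\ b = d) \/ (a = d /\ b = c).
Proof.
move=> e; have : a \in [set c; d] by rewrite -e set21.
have : b \in [set c; d] by rewrite -e set22.
have : c \in [set a; b] by rewrite e set21.
have : d \in [set a; b] by rewrite e set22.
by rewrite !inE; do 4!case/orP=> /eqP ?; subst; auto.
Qed.

Lemma adjacent_XG n k (A B : {set 'I_n}) : 0 < k ->
  adjacent (XG n k) A B <-> xedge k 0 (to_nset A) (to_nset B).
Proof.
move=> k_gt0; rewrite /adjacent inE; split=> [/andP[_ /existsP[A' /existsP[B']]]|e].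
  case/andP=> /eqP/set2_eq[[-> ->]|[-> ->]] /almost_xedge => [/(_ k_gt0)//|/(_ k_gt0)].
  exact: xedge_sym.
have almost := xedge_almost k_gt0 e; have /and4P[AV BV dAB _] := almost.
apply/andP; split; last by apply/existsP; exists A; apply/existsP; exists B; rewrite eqxx.
apply/imset2P; exists A B => //; rewrite inE BV dAB andbT /=.
apply: contraTneq dAB => <-; rewrite -setI_eq0 setIid -card_gt0.
by have /SG_verticesP[->] := AV.
Qed.

Lemma adjacent_vertices (T : finType) (G : graph T) (a b : T) :
  adjacent G a b -> a \in vertices G /\ b \in vertices G.
Proof. by case/edgesP=> /subsetP sub _; split; apply: sub; rewrite !inE eqxx ?orbT. Qed.

Lemma colorableP (T : finType) (G : graph T) (m : nat) :
  reflect (exists f : T -> nat, (forall a, a \in vertices G -> f a < m) /\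
     forall a b, adjacent G a b -> f a != f b)
  (colorable G m).
Proof.
apply: (iffP existsP) => [[f /forallP fP]|[f [fm fP]]].
  exists (fun x : T => if insub x is Some v then nat_of_ord (f v) else 0).
  split=> [x xV|x y xy].
    by rewrite insubT ltn_ord.
  have [xV yV] := adjacent_vertices xy; rewrite !insubT.
  have /forallP/(_ (Sub y yV)) := fP (Sub x xV).
  by rewrite !SubK xy.
exists [ffun v => Ordinal (fm (val v) (valP v))].
apply/forallP=> x; apply/forallP=> y; apply/implyP=> /fP.
by rewrite !ffunE -(inj_eq val_inj).
Qed.

Lemma XG_not_colorable n k m : 0 < k -> 2 * k <= n -> m <= n - 2 * k + 1 ->
  ~~ colorable (XG n k) m.
Proof.
case: k => // k _ kn mn; apply/negP=> /colorableP[f [fm fP]].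
have adj A B : edge_below k.+1 n A B ->
    adjacent (XG n k.+1) (of_nset n A) (of_nset n B).
  by case=> e lA lB; apply/adjacent_XG; rewrite // !of_nsetK.
apply: (xedge_not_colorable (k := k) (d := n - 2 * k.+1)
    (c := fun S => f (of_nset n S)));
  move=> A B; rewrite subnKC // => /adj AB; first by apply/eqP/fP.
have [AV _] := adjacent_vertices AB.
by have := leq_trans (fm _ AV) mn; rewrite addn1.
Qed.

Lemma XG_del_colorable n k e : 0 < k -> 2 * k <= n -> e \in edges (XG n k) ->
  colorable (del_edge (XG n k) e) (n - 2 * k + 1).
Proof.
case: k => // k _ kn eX.
have [A [B eE]] : exists A B : {set 'I_n}, e = [set A; B].
  by move: eX; rewrite inE => /andP[/imset2P[A B _ _ ->] _]; exists A, B.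
have /adjacent_XG eAB : adjacent (XG n k.+1) A B by rewrite /adjacent -eE.
have [f [K [inK cK fK isoK]]] :=
  xedge_isolates (eAB isT) (@to_nset_lt n A) (@to_nset_lt n B).
apply/colorableP; exists (fun U => index (f (to_nset U)) (enum_fset K)).
split=> [U _|U V].
  have <- : #|`K|%fset = n - 2 * k.+1 + 1 by move: cK kn; clear; lia.
  by rewrite index_mem fK.
rewrite /adjacent in_setD1 => /andP[UVe /adjacent_XG eUV].
apply/negP=> /eqP/(congr1 (nth 0 (enum_fset K))); rewrite !nth_index ?fK // => eqf.
case/negP: UVe; rewrite eE.
have /(_ eqf) := isoK _ _ (eUV isT) (@to_nset_lt n U) (@to_nset_lt n V).
by case=> [[/(can_inj (@to_nsetK n))-> /(can_inj (@to_nsetK n))->]|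
  [/(can_inj (@to_nsetK n))-> /(can_inj (@to_nsetK n))->]]; rewrite // setUC.
Qed.

(** The rotation of [A] by one position interlaces with [A], without any cut. Hence deleting a
    vertex always deletes an edge. *)
Lemma XG_neighbour n k (A : {set 'I_n}) : 0 < k -> A \in SG_vertices n k ->
  exists B : {set 'I_n}, adjacent (XG n k) A B.
Proof.
move=> k_gt0 AV; have /SG_verticesP[cA sA] := AV.
pose B := [set ordS i | i in A]; exists B.
have dAB : [disjoint A & B].
  rewrite disjoint_subset; apply/subsetP=> i iA; rewrite inE.
  by apply/imsetP=> [[j jA ij]]; move: (sA j jA); rewrite -ij iA.
have BV : B \in SG_vertices n k.
  apply/SG_verticesP; split; first by rewrite card_imset //; apply: ordS_inj.
  move=> _ /imsetP[j jA ->]; rewrite mem_imset; last exact: ordS_inj.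
  exact: sA.
apply/adjacent_XG => //; apply: almost_xedge => //; apply/and4P; split=> //.
have [i0 i0A] : exists i0, i0 \in A by apply/card_gt0P; rewrite cA.
apply/existsP; exists ord0; apply/existsP; exists [ffun=> i0].
apply/existsP; exists [ffun=> i0]; apply/and5P; split; try by apply/forallP=> -[].
apply/andP; split; first by apply/forallP=> -[].
have -> : enum 'I_(@ord0 n) = [::] by apply: size0nil; rewrite size_enum_ord.
rewrite /= /interlacing dAB /=; apply/forall_inP=> x xZ; apply/forall_inP=> y yZ.
apply/implyP=> /andP[xy /forall_inP nb]; apply/andP; split; apply/negP=> /andP[].
  move=> xA yA; have sxB : ordS x \in B by apply: imset_f.
  have vS : val (ordS x) = x.+1 by rewrite /= modn_small // (leq_ltn_trans xy).
  have := nb (ordS x); rewrite in_setU sxB orbT => /(_ isT).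
  rewrite -[nat_of_ord (ordS x)]/(val _) vS ltnSn /= -leqNgt leq_eqVlt ltnNge xy orbF.
  move=> /eqP yx; have := disjointFr dAB yA.
  suff -> : y = ordS x by rewrite sxB.
  by apply: val_inj; rewrite vS.
move=> xB /imsetP[j jA yE].
have vS : val y = j.+1.
  rewrite yE /=; have [ltjn|lenj] := ltnP j.+1 n; first by rewrite modn_small.
  have jn : j.+1 = n by apply/eqP; rewrite eqn_leq lenj ltn_ord.
  by move: xy; rewrite yE /= jn modnn.
have := nb j; rewrite in_setU jA => /(_ isT).
rewrite -[nat_of_ord y]/(val _) vS ltnSn andbT -leqNgt => jx.
have xj : x <= j by rewrite -ltnS -vS.
have := disjointFr dAB jA; suff <- : x = j by rewrite xB.
by apply/val_inj/eqP; rewrite eqn_leq xj.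
Qed.

Theorem theorem1p1 (n k : nat) (hk : 1 <= k) (hn : 2 * k <= n) :
  chromatic_number (XG n k) = n - 2 * k + 2 /\ edge_critical (XG n k).
Proof.
have [A [B AB]] : exists A B : {set 'I_n}, adjacent (XG n k) A B.
  have [A [B [e lA lB _]]] := xedge_ex k 0.
  exists (of_nset n A), (of_nset n B); apply/adjacent_XG => //.
  by rewrite !of_nsetK // => x; [move/lB|move/lA]; rewrite add0n => /leq_trans; apply.
have chi_ub (T : finType) (G : graph T) m : colorable G m -> chromatic_number G <= m.
  by rewrite /chromatic_number; case: ex_minnP => c _ cmin; apply: cmin.
have chi : chromatic_number (XG n k) = n - 2 * k + 2.
  apply/eqP; rewrite eqn_leq; apply/andP; split; last first.
    rewrite /chromatic_number; case: ex_minnP => m mcol _; rewrite leqNgt.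
    apply: contraL mcol => mn; apply: XG_not_colorable => //.
    by rewrite addn2 ltnS in mn; rewrite addn1.
  (* One additional colour, given to the end [A] of the deleted edge, makes the colouring proper
     again. *)
  apply: chi_ub; have /colorableP[f [fm fP]] := XG_del_colorable hk hn AB.
  apply/colorableP; exists (fun U => if U == A then n - 2 * k + 1 else f U).
  split=> [U UV|U V UV].
    case: eqP => _; first by rewrite addn1 addn2.
    by apply: leq_trans (fm U UV) _; rewrite leq_add2l.
  have [UVs VVs] := adjacent_vertices UV.
  have UneqV : U != V.
    by have [_] := edgesP UV; rewrite cards2; case: eqP.
  have ltf W : W \in SG_vertices n k -> f W != n - 2 * k + 1.
    by move/fm; apply: contraTneq => ->; rewrite ltnn.
  case: (U =P A) => [UA|nUA]; case: (V =P A) => [VA|nVA].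
  - by rewrite UA VA eqxx in UneqV.
  - by rewrite eq_sym ltf.
  - by rewrite ltf.
  apply: fP; rewrite /adjacent in_setD1 [_ \in edges _]UV andbT.
  by apply/eqP=> /set2_eq[[]|[]].
have sub_lt (H : graph {set 'I_n}) e : subgraph H (XG n k) ->
    e \in edges (XG n k) -> e \notin edges H -> chromatic_number H < chromatic_number (XG n k).
  move=> /andP[/subsetP sV /subsetP sE] eX eH; rewrite chi addn2 ltnS -addn1.
  apply: chi_ub; have /colorableP[f [fm fP]] := XG_del_colorable hk hn eX.
  apply/colorableP; exists f; split=> [U /sV/fm//|U V UV]; apply: fP.
  rewrite /adjacent in_setD1 sE // andbT.
  by apply: contraNneq eH => <-.
split=> //; split=> [e eX|H].
  apply: sub_lt eX _; last by rewrite in_setD1 eqxx.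
  by rewrite /subgraph subxx /=; apply/subsetP=> x /setD1P[].
case/andP=> HX; have /andP[sV sE] := HX; case/orP=> neq.
  have /subsetPn[U UX UH] : ~~ (vertices (XG n k) \subset vertices H).
    by move: neq; rewrite eqEsubset sV.
  have [V UV] := XG_neighbour hk UX.
  apply: (sub_lt _ _ HX UV); apply/negP=> /edgesP[/subsetP sub _].
  by case/negP: UH; apply: sub; rewrite !inE eqxx.
have /subsetPn[e eX eH] : ~~ (edges (XG n k) \subset edges H).
  by move: neq; rewrite eqEsubset sE.
exact: sub_lt HX eX eH.
Qed.
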